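(* For every integer $n\ge 3$, one has $\operatorname{MaxCol}(n,3)\ge 2^{\lfloor n/2\rfloor}$.
   Context: $\operatorname{MaxCol}(n,d)$ denotes the maximum number of collisions that may occur between $n$ identical hard balls moving freely and colliding elastically in $\mathbb{R}^d$ (open space), where simultaneous collisions are prohibited. (It is known to be finite; $\operatorname{MaxCol}(n,d)\ge N$ means that there is a trajectory with at least $N$ collisions.) Precisely: the balls have radius $\frac12$ and centers $q_1,\dots,q_n\in\mathbb{R}^d$; a configuration is a point $q=(q_1,\dots,q_n)\in\mathbb{R}^{dn}$, and the configuration space is $\mathcal B_{d,n}=\{q\in\mathbb{R}^{dn}: |q_i-q_j|\ge 1 \text{ for all } i\ne j\}$. For $i<j$ let $C_{ij}=\{q\in\mathbb{R}^{dn}:|q_i-q_j|<1\}$; the walls are the boundaries $\partial C_{ij}=\{|q_i-q_j|=1\}$. At a point $q\in\partial C_{ij}$ the unit outer normal to $C_{ij}$ is the vector $\nu\in\mathbb{R}^{dn}$ whose $i$th $d$-dimensional component is $\frac1{\sqrt2}(q_i-q_j)$, whose $j$th one is $\frac1{\sqrt2}(q_j-q_i)$, and whose other components are $0$. A trajectory is a continuous piecewise linear curve $\gamma\colon I\to\mathcal B_{d,n}$ on an interval $I\subset\mathbb{R}$ which never lies on two distinct walls at the same moment (no simultaneous collisions), is linear near every moment at which it lies on no wall, and at every moment $t$ at which it lies on a wall with normal $\nu$ at $\gamma(t)$ satisfies the elastic (billiard) reflection rule $\gamma'(t_+)=\gamma'(t_-)-2\langle\gamma'(t_-),\nu\rangle\nu$.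 A collision is a moment $t$ at which $\gamma(t)$ lies on a wall and $\langle\gamma'(t_-),\nu\rangle\ne0$; no collisions occur at endpoints of $I$. *)

(* Defs.v *)
From HB Require Import structures.
From mathcomp Require Import all_boot all_order all_algebra.
From mathcomp Require Import all_classical all_reals all_analysis.

Set Implicit Arguments.
Unset Strict Implicit.
Unset Printing Implicit Defensive.

Import Order.TTheory GRing.Theory Num.Theory.
Import numFieldNormedType.Exports.

Local Open Scope classical_set_scope.
Local Open Scope ring_scope.

(* The library norm on matrices is the sup norm, so the Euclidean structure of
   R^d and of R^(dn) is spelled out here. *)
Definition dot (R : realType) (m k : nat) (A B : 'M[R]_(m, k)) : R :=
  \sum_i \sum_j A i j * B i j.

Definition enorm (R : realType) (m k : nat) (A : 'M[R]_(m, k)) : R :=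
  Num.sqrt (dot A A).

(* A configuration q in R^(dn) is an n x d matrix: row i is the center q_i. *)
Definition config (R : realType) (n d : nat) : set 'M[R]_(n, d) :=
  [set q | forall i j, i != j -> 1 <= enorm (row i q - row j q)].

Definition on_wall (R : realType) (n d : nat) (i j : 'I_n) (q : 'M[R]_(n, d)) :=
  enorm (row i q - row j q) = 1.

Definition wall_normal (R : realType) (n d : nat) (i j : 'I_n) (q : 'M[R]_(n, d)) :
    'M[R]_(n, d) :=
  \matrix_k (if k == i then (Num.sqrt 2)^-1 *: (row i q - row j q)
             else if k == j then (Num.sqrt 2)^-1 *: (row j q - row i q)
             else 0).

Definition lderiv (R : realType) (n d : nat) (g : R -> 'M[R]_(n, d)) (t : R) :
    'M[R]_(n, d) :=
  lim ((s - t)^-1 *: (g s - g t) @[s --> t^'-]).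

Definition rderiv (R : realType) (n d : nat) (g : R -> 'M[R]_(n, d)) (t : R) :
    'M[R]_(n, d) :=
  lim ((s - t)^-1 *: (g s - g t) @[s --> t^'+]).

Definition linear_on (R : realType) (n d : nat) (J : set R)
    (g : R -> 'M[R]_(n, d)) :=
  exists a v : 'M[R]_(n, d), forall s, J s -> g s = a + s *: v.

(* Piecewise linear with a locally finite set of break points: linear on a
   one-sided neighborhood in I, on either side of every point of I. *)
Definition piecewise_linear (R : realType) (n d : nat) (I : set R)
    (g : R -> 'M[R]_(n, d)) :=
  forall t, I t -> exists2 e : R, 0 < e &
    linear_on (I `&` `[t - e, t]) g /\ linear_on (I `&` `[t, t + e]) g.

(* g is only meaningful on I; the second clause says that t is not the left
   endpoint of I, i.e., that the velocity g'(t-) makes sense. *)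
Definition collision (R : realType) (n d : nat) (I : set R)
    (g : R -> 'M[R]_(n, d)) : set R :=
  [set t | [/\ I t, exists2 s, I s & s < t &
    exists i j : 'I_n, [/\ (i < j)%N, on_wall i j (g t) &
      dot (lderiv g t) (wall_normal i j (g t)) != 0]]].

Record trajectory (R : realType) (n d : nat) (I : set R)
    (g : R -> 'M[R]_(n, d)) : Prop := Trajectory {
  traj_interval : is_interval I ;
  traj_continuous : {within I, continuous g} ;
  traj_piecewise_linear : piecewise_linear I g ;
  traj_config : forall t, I t -> config (g t) ;
  traj_not_simultaneous : forall t (i j k l : 'I_n), I t ->
    (i < j)%N -> (k < l)%N -> on_wall i j (g t) -> on_wall k l (g t) ->
    i = k /\ j = l ;
  traj_free : forall t, I t ->
    (forall i j : 'I_n, (i < j)%N -> ~ on_wall i j (g t)) ->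
    exists2 e : R, 0 < e & linear_on (I `&` `[t - e, t + e]) g ;
  traj_reflection : forall t (i j : 'I_n), I° t ->
    (i < j)%N -> on_wall i j (g t) ->
    rderiv g t = lderiv g t
      - (2 * dot (lderiv g t) (wall_normal i j (g t))) *: wall_normal i j (g t) ;
  traj_endpoints : collision I g `<=` I°
}.

(* The largest number of collisions in a trajectory; it is known to be finite,
   but is taken in the extended reals to be defined as a supremum. *)
Definition MaxCol (R : realType) (n d : nat) : \bar R :=
  ereal_sup [set c : \bar R | exists (I : set R) (g : R -> 'M[R]_(n, d)),
    trajectory I g /\ c = counting (collision I g)].

(* Main.v *)
Require Import Defs.
From mathcomp Require Import all_boot all_order all_algebra.
From mathcomp Require Import all_classical all_reals all_analysis.
From mathcomp Require Import zify ring lra.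

Set Implicit Arguments.
Unset Strict Implicit.
Unset Printing Implicit Defensive.

Import Order.TTheory GRing.Theory Num.Theory.
Import numFieldNormedType.Exports.

Local Open Scope classical_set_scope.
Local Open Scope ring_scope.

(** Why the bound holds.

    The balls 0, ..., K with K = n - 1 are placed so that ball k >= 1 touches
    ball [par k], the largest even number below k: the contact graph is a
    caterpillar, whose spine consists of the even balls and whose leaves are
    the odd ones.  Call the contact between k and [par k] edge k.  The edges
    2q, 2q+1 and 2q+2 meet at the spine ball 2q, and their directions are
    nearly orthogonal there.  All motions take place in a tiny neighbourhood
    of this configuration, where the walls are almost hyperplanes.

    A small parameter t separates the scales: edge k has normal speed of order
    t^k, so that edges of larger index are slower.  A collision on edge k
    reverses the normal speed of k and changes that of an edge l meeting k in
    proportion to the inner product of the two contact directions.  That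
    product is taken close to 2 t^(l-k) in absolute value for k < l, with the
    sign for which the change lets l approach.  Then, measured in units of
    their own scale, the slower edges that meet k feel a change of exactly -2 in
    the limit t -> 0, and the faster ones feel nothing.  In the limit the normal
    speeds are 1 or -1, and a collision on k sends those slower edges, if they
    are receding, back towards a collision of their own.

    So the limiting clearance of edge l is the distance from the current time
    to a finite set H_l of hit times, and the only condition is that the
    midpoints of consecutive elements of H_l are exactly the hit times of the
    faster edges meeting l ([kicks]).  Hence H_l has one more element than
    these sets together ([nhit]), which makes the number of hits double each
    time two balls are added: the total is at least 2^(n/2) ([sum_nhit]).
    Such sets exist and can be taken pairwise disjoint ([hit_times_exist]):
    one starts from equally spaced times and perturbs the first hit of each
    edge generically.  Sorted by time, the hits form a [schedule].

    It remains to realise the schedule by hard balls.  Following the scheduled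
    collisions one after the other, with the flight times given by the
    quadratic formula, defines for each t a motion all of whose rescaled data
    converge, as t tends to 0 from the right, to the data of the schedule
    ([stage_sim]).  For small t the finitely many strict inequalities that make
    it a trajectory therefore hold ([exists_good]), and such a list of
    collisions assembles into a billiard trajectory ([billiard_MaxCol]). *)

(** * Euclidean geometry of configurations *)

Section Dot.
Variables (R : realType) (m k : nat).
Implicit Types (A B C : 'M[R]_(m, k)) (c : R).

Lemma dotC A B : dot A B = dot B A.
Proof. by apply: eq_bigr => i _; apply: eq_bigr => j _; rewrite mulrC. Qed.

Lemma dotDl A B C : dot (A + B) C = dot A C + dot B C.
Proof.
rewrite /dot -big_split; apply: eq_bigr => i _; rewrite -big_split.
by apply: eq_bigr => j _; rewrite mxE mulrDl.
Qed.

Lemma dotZl c A B : dot (c *: A) B = c * dot A B.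
Proof.
rewrite /dot mulr_sumr; apply: eq_bigr => i _; rewrite mulr_sumr.
by apply: eq_bigr => j _; rewrite mxE mulrA.
Qed.

Lemma dotNl A B : dot (- A) B = - dot A B.
Proof. by rewrite -scaleN1r dotZl mulN1r. Qed.

Lemma dotBl A B C : dot (A - B) C = dot A C - dot B C.
Proof. by rewrite dotDl dotNl. Qed.

Lemma dotDr A B C : dot A (B + C) = dot A B + dot A C.
Proof. by rewrite dotC dotDl !(dotC A). Qed.

Lemma dotZr c A B : dot A (c *: B) = c * dot A B.
Proof. by rewrite dotC dotZl dotC. Qed.

Lemma dotNr A B : dot A (- B) = - dot A B.
Proof. by rewrite dotC dotNl dotC. Qed.

Lemma dotBr A B C : dot A (B - C) = dot A B - dot A C.
Proof. by rewrite dotDr dotNr. Qed.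

Definition dotE := (dotDl, dotBl, dotNl, dotZl, dotDr, dotBr, dotNr, dotZr).

Lemma dot_ge0 A : 0 <= dot A A.
Proof. by apply: sumr_ge0 => i _; apply: sumr_ge0 => j _; rewrite -expr2 sqr_ge0. Qed.

Lemma enorm_eq1 A : (enorm A = 1) <-> (dot A A = 1).
Proof.
split=> [H|H]; last by rewrite /enorm H sqrtr1.
by rewrite -[LHS]sqr_sqrtr ?dot_ge0 // -/(enorm A) H expr1n.
Qed.

Lemma enorm_ge1 A : (1 <= enorm A) = (1 <= dot A A).
Proof. by rewrite -{1}sqrtr1 /enorm ler_sqrt ?dot_ge0. Qed.

End Dot.

Lemma cvg_sumr (R : realType) (T : Type) (F : set_system T) (FF : Filter F)
    (V : normedModType R) (I : Type) (r : seq I) (f : I -> T -> V) (a : I -> V) :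
  (forall i, f i x @[x --> F] --> a i) ->
  \sum_(i <- r) f i x @[x --> F] --> \sum_(i <- r) a i.
Proof.
move=> H; elim: r => [|i r IH].
  by rewrite big_nil; under eq_fun do rewrite big_nil; exact: cvg_cst.
by rewrite big_cons; under eq_fun do rewrite big_cons; apply: cvgD.
Qed.

(** * Hit times of the limiting dynamics *)

Section HitTimes.
Variable R : realFieldType.
Implicit Types (h : nat -> nat -> R) (k l i j K : nat) (e x : R).

(** An edge recedes after each hit and has to be kicked exactly once before the
    next one, so [nhit l] is one more than the sum of [nhit k] over the edges k
    with [kicks k l].  For l = 2q+2 these are 2q and 2q+1, and [nhit (2q+1)] is
    [nhit (2q) + 1], whence the doubling.  Edge 0 is fictitious and never hit. *)
Fixpoint nhit k : nat :=
  if k is k'.+1 then (if odd k' then (nhit k').*2 else (nhit k').+1)%N else 0%N.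

(** The edges meeting at the spine ball 2q are 2q, 2q+1 and 2q+2, and each is
    kicked by those of smaller index, which are faster. *)
Definition kicks k l : bool := (l == k.+1) || (~~ odd k && (l == k.+2)).

(** The j-th kick received by edge [k.+1].  For a spine edge the hits of the two
    kicking edges alternate, those of the leaf coming first and last, because
    the hits of the spine edge [k.-1] are midpoints of hits of the leaf k. *)
Definition kick h k j : R :=
  if odd k then (if odd j then h k.-1 j./2 else h k j./2) else h k j.

Lemma kick_hit k j : (j.+1 < nhit k.+1)%N ->
  exists k' i, [/\ kicks k' k.+1, (i < nhit k')%N & forall h, kick h k j = h k' i].
Proof.
rewrite /kick /kicks [nhit _]/=; case: ifP => ok Hj; last first.
  by exists k, j; split => //; rewrite eqxx.
case oj: (odd j); last by exists k, j./2; split=> //; [rewrite eqxx | lia].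
exists k.-1, j./2; split => //.
  by apply/orP; right; case: k ok {Hj} => //= k ok; rewrite ok eqxx.
case: k ok Hj => //= k ok; rewrite (negbTE ok); lia.
Qed.

Lemma hit_kick k k' i : kicks k' k.+1 -> (i < nhit k')%N ->
  exists2 j, (j.+1 < nhit k.+1)%N & forall h, kick h k j = h k' i.
Proof.
rewrite /kick /kicks => /orP[|].
  rewrite eqSS => /eqP ->; case ok: (odd k') => Hi /=; rewrite ?ok.
    by exists i.*2; [lia | move=> h; rewrite odd_double doubleK].
  by exists i; [lia | ].
move=> /andP[ok']; rewrite eqSS => /eqP -> Hi.
exists i.*2.+1; rewrite /= ok' ?(negbTE ok') //; first by lia.
by move=> h; rewrite /= odd_double /= uphalf_double.
Qed.

Fixpoint gap k : R :=
  if k is k'.+1 then (if odd k' then gap k' / 2 else gap k') else 1.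

Lemma gap_gt0 k : 0 < gap k.
Proof. by elim: k => [|k IH] //=; case: ifP => // _; rewrite divr_gt0. Qed.

Lemma gap_decr k : gap k.+1 <= gap k.
Proof. by rewrite /=; case: ifP => // _; move: (gap_gt0 k); lra. Qed.

Lemma gap_nincr k l : (k <= l)%N -> gap l <= gap k.
Proof.
elim: l => [|l IH]; first by rewrite leqn0 => /eqP ->.
rewrite leq_eqVlt => /orP[/eqP -> //|]; rewrite ltnS => /IH.
by apply: le_trans; exact: gap_decr.
Qed.

(** The equally spaced solution of the midpoint equations.  It is not usable as
    it stands, since it makes different edges collide at the same time, already
    edges 1 and 3 at time 0. *)
Definition ideal k i : R := ((2 * i).+1%:R - (nhit k)%:R) * gap k / 2.

Lemma ideal_mid k j : ideal k.+1 j + gap k.+1 / 2 = kick ideal k j.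
Proof.
rewrite /kick /ideal [gap k.+1]/= [nhit k.+1]/=; case: ifP => ok; last first.
  by rewrite !(natrM, mulrS); field.
case: ifP => oj; last first.
  have [m ->] : exists m, j = (2 * m)%N by exists j./2; lia.
  rewrite (_ : (2 * m)./2 = m); last by lia.
  by rewrite -mul2n !(natrM, mulrS); field.
case: k ok => //= k ok; rewrite (negbTE ok).
have [m ->] : exists m, j = (2 * m).+1%N by exists j./2; lia.
rewrite (_ : (2 * m).+1./2 = m) -?mul2n; last by lia.
by rewrite !(natrM, mulrS); field.
Qed.

Lemma ideal_step k i : ideal k i.+1 = ideal k i + gap k.
Proof. by rewrite /ideal mulnS !(natrM, mulrS); field. Qed.

Lemma ideal_gap k i i' : (i < i')%N -> ideal k i + gap k <= ideal k i'.
Proof.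
elim: i' => // i' IH; rewrite ltnS leq_eqVlt ideal_step => /orP[/eqP -> //|/IH].
by have := gap_gt0 k; lra.
Qed.

(** [hits_near] serves to order hits and kicks, [hits_mid] says that each kick is
    halfway between two hits, and [hits_inj] excludes simultaneous collisions. *)
Record hit_times K e h : Prop := HitTimes {
  hits_near : forall k i, (k <= K)%N -> (i < nhit k)%N -> `|h k i - ideal k i| <= e ;
  hits_mid : forall k j, (k < K)%N -> (j.+1 < nhit k.+1)%N ->
    h k.+1 j + h k.+1 j.+1 = 2 * kick h k j ;
  hits_inj : forall k k' i i', (k <= K)%N -> (k' <= K)%N ->
    (i < nhit k)%N -> (i' < nhit k')%N -> h k i = h k' i' -> k = k' /\ i = i' }.

Lemma hit_times_le K e e' h : e <= e' -> hit_times K e h -> hit_times K e' h.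
Proof.
by move=> ee [H1 H2 H3]; split => // k i kK iN; apply: le_trans (H1 _ _ kK iN) ee.
Qed.

Lemma exists_small_notin e (s : seq R) : 0 < e -> exists x, [/\ 0 < x, x <= e & x \notin s].
Proof.
move=> e0; have [x [x0 xe Hx]] : exists x, [/\ 0 < x, x <= e &
    forall z, z \in s -> 0 < z -> x < z].
  elim: s => [|z s [x [x0 xe Hx]]]; first by exists e.
  case: (ltP 0 z) => z0; last first.
    exists x; split => // y; rewrite inE => /orP[/eqP -> y0|]; last exact: Hx.
    by move: y0 z0; lra.
  have m0 : 0 < Num.min x z by rewrite lt_min x0.
  have mx : Num.min x z <= x by rewrite ge_min lexx.
  have mz : Num.min x z <= z by rewrite ge_min lexx orbT.
  exists (Num.min x z / 2); split; [by lra | by lra |].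
  move=> y; rewrite inE => /orP[/eqP -> _|/Hx H /H]; by lra.
exists x; split => //; apply/negP => /Hx /(_ x0); by rewrite ltxx.
Qed.

(** The midpoint equations determine all hits of an edge from its first hit: each
    hit is the mirror image of the previous one in the kick between them. *)
Fixpoint mirror (u : nat -> R) (a : R) j : R :=
  if j is j'.+1 then 2 * u j' - mirror u a j' else a.

(** Every hit moves at unit rate with the first one, so any finite set of
    coincidences is avoided by a small generic change of the first hit. *)
Lemma mirrorD u a x j : mirror u (a + x) j = mirror u a j + (-1) ^+ j * x.
Proof.
elim: j => [|j IH] /=; first by rewrite expr0 mul1r.
by rewrite IH exprS; ring.
Qed.

(** The errors in the kicks accumulate at most linearly along the recursion, hence
    stay small if the kicks are close enough to equal spacing. *)
Lemma mirror_near h k e x j : 0 <= e ->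
  (forall i, (i < j)%N -> `|kick h k i - kick ideal k i| <= e) ->
  `|mirror (kick h k) (ideal k.+1 0 + x) j - ideal k.+1 j| <= `|x| + j%:R * (2 * e).
Proof.
move=> e0; elim: j => [|j IH] H /=.
  by rewrite mul0r addr0 [_ + x]addrC addrK.
have {}IH := IH (fun i ij => H i (ltnW ij)).
have Hj := H j (ltnSn j).
rewrite ideal_step.
have E : ideal k.+1 j = kick ideal k j - gap k.+1 / 2 by rewrite -ideal_mid addrK.
move: IH; rewrite E -[j.+1%:R]natr1 => IH.
move: Hj IH; rewrite !ler_norml => /andP[A B] /andP[C D]; apply/andP; split; lra.
Qed.

Lemma hits_mono K e h k i i' : e <= gap K / 8 -> hit_times K e h ->
  (k <= K)%N -> (i < i')%N -> (i' < nhit k)%N -> h k i + gap k / 2 < h k i'.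
Proof.
move=> eK [H _ _] kK ii' iN.
have Hi := H _ _ kK (ltn_trans ii' iN); have Hi' := H _ _ kK iN.
have gk : gap K <= gap k by apply: gap_nincr.
have D := ideal_gap k ii'.
by have := gap_gt0 k; move: Hi Hi'; rewrite !ler_norml => /andP[? ?] /andP[? ?]; lra.
Qed.

(** Induction on the number of edges.  The tolerance is arbitrary because that of
    the faster edges has to be much smaller than that of the new edge. *)
Lemma hit_times_exist K e : 0 < e -> exists h, hit_times K e h.
Proof.
elim: K e => [|K IH] e e0.
  by exists (fun _ _ => 0); split => [k i|//|k k' i i']; rewrite leqn0 => /eqP ->.
wlog eg : e e0 / e <= gap K.+1 / 8.
  move=> H; have m0 : 0 < Num.min e (gap K.+1 / 8).
    by rewrite lt_min e0 divr_gt0 // gap_gt0.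
  have [|h Hh] := H _ m0; first by rewrite ge_min lexx orbT.
  by exists h; apply: hit_times_le Hh; rewrite ge_min lexx.
pose n := nhit K.+1.
pose e1 := e / 4 / n.+1%:R.
have e10 : 0 < e1 by rewrite !divr_gt0.
have e1e : e1 * n.+1%:R = e / 4 by rewrite /e1 -mulrA mulVf ?mulr1 // pnatr_eq0.
have n0 : (0 : R) <= n%:R by [].
have e1n : n%:R * (2 * e1) <= e / 2 by move: e1e; rewrite -natr1; lra.
have e1le : e1 <= e by move: e1e (mulr_ge0 (ltW e10) n0); rewrite -natr1; lra.
have [h [H1 H2 H3]] := IH _ e10.
pose r := mirror (kick h K) (ideal K.+1 0).
have [x [x0 xe xbad]] := @exists_small_notin (e / 2)
  (flatten [seq flatten [seq [seq (-1) ^+ j * (h k i - r j) | i <- iota 0 (nhit k)]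
     | k <- iota 0 K.+1] | j <- iota 0 n]) ltac:(lra).
pose rx := mirror (kick h K) (ideal K.+1 0 + x).
pose h' k := if k == K.+1 then rx else h k.
have h'E k : (k <= K)%N -> h' k = h k by move=> kK; rewrite /h' ltn_eqF.
have h'K : h' K.+1 = rx by rewrite /h' eqxx.
have kickE k j : (k <= K)%N -> kick h' k j = kick h k j.
  by move=> kK; rewrite /kick !h'E //; lia.
have near k i : (k <= K.+1)%N -> (i < nhit k)%N -> `|h' k i - ideal k i| <= e.
  rewrite leq_eqVlt => /orP[/eqP -> iN|kK iN]; last first.
    by rewrite h'E //; apply: le_trans (H1 _ _ kK iN) e1le.
  rewrite h'K; apply: le_trans (@mirror_near h K e1 x i (ltW e10) _) _.
    move=> j ji; have [|k' [i' [kk i'N E]]] := @kick_hit K j; first by apply: leq_trans iN.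
    by rewrite !E; apply: H1 => //; move: kk; rewrite /kicks; lia.
  rewrite gtr0_norm //; have : (i%:R : R) <= n%:R by rewrite ler_nat ltnW.
  by move=> ?; nra.
(* the choice of x keeps the new hits away from all earlier ones *)
have new k i j : (k <= K)%N -> (i < nhit k)%N -> (j < n)%N -> h k i <> rx j.
  move=> kK iN jn E; move/negP: xbad; apply.
  apply/flatten_mapP; exists j; first by rewrite mem_iota.
  apply/flatten_mapP; exists k; first by rewrite mem_iota.
  apply/mapP; exists i; first by rewrite mem_iota.
  rewrite E /rx mirrorD -/r [r j + _]addrC addrK mulrA -exprD addnn -mul2n exprM.
  by rewrite sqrrN expr1n expr1n mul1r.
have base : hit_times K.+1 e h'; last by exists h'.
split => // [k j|k k' i i'].
  rewrite ltnS leq_eqVlt => /orP[/eqP -> jN|kK jN].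
    by rewrite h'K kickE // /rx /=; ring.
  by rewrite !h'E ?kickE ?(ltnW kK) //; apply: H2.
rewrite leq_eqVlt ltnS => /orP[/eqP -> |kK]; rewrite leq_eqVlt ltnS => /orP[/eqP -> |kK'] iN iN'.
- move=> E; split => //; apply/eqP; apply: contraT => ne.
  suff Hlt a b : (a < b)%N -> (b < n)%N -> h' K.+1 a < h' K.+1 b.
    by move: ne; rewrite neq_ltn => /orP[/Hlt|/Hlt] => /(_ ltac:(assumption)); rewrite E ltxx.
  move=> ab bn; have Ha := near K.+1 a (leqnn _) (ltn_trans ab bn).
  have Hb := near K.+1 b (leqnn _) bn.
  have D := ideal_gap K.+1 ab.
  by have := gap_gt0 K.+1; move: Ha Hb; rewrite !ler_norml => /andP[? ?] /andP[? ?]; lra.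
- by rewrite h'K h'E // => /esym /(new _ _ _ kK' iN' iN).
- by rewrite h'K h'E // => /(new _ _ _ kK iN iN').
- by rewrite !h'E //; apply: H3.
Qed.
(** * From hit times to a schedule *)

(** The change of normal speed of edge l per unit of normal speed with which edge
    k collides; since that speed is -1, a kick amounts to -2. *)
Definition response k l : R := if l == k then - 2 else if kicks k l then 2 else 0.

(** The limiting dynamics: at time [t m.+1] edge [ed m] is hit, [y m k] is the
    clearance of edge k at time [t m], and [s m k] its slope from [t m] to
    [t m.+1]. *)
Record schedule K M (t : nat -> R) (ed : nat -> nat) (y s : nat -> nat -> R) : Prop :=
  Schedule {
  sched_start : forall k, (0 < k <= K)%N -> s 0%N k = -1 /\ 0 < y 0%N k ;
  sched_time : forall m, (m < M)%N -> t m < t m.+1 ;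
  sched_edge : forall m, (m < M)%N -> (0 < ed m <= K)%N ;
  sched_slope : forall m k, (m <= M)%N -> (0 < k <= K)%N -> s m k = 1 \/ s m k = -1 ;
  sched_flight : forall m k, (m < M)%N -> (0 < k <= K)%N ->
    y m.+1 k = y m k + (t m.+1 - t m) * s m k ;
  sched_hit : forall m, (m < M)%N -> y m.+1 (ed m) = 0 /\ s m (ed m) = -1 ;
  sched_miss : forall m k, (m < M)%N -> (0 < k <= K)%N -> k != ed m -> 0 < y m.+1 k ;
  sched_kick : forall m k, (m < M)%N -> (0 < k <= K)%N ->
    s m.+1 k = s m k + response (ed m) k * s m (ed m) ;
  sched_end : forall k, (0 < k <= K)%N -> s M k = 1 }.

(** The number of break points up to t, if they increase. *)
Definition rank (z : nat -> R) n t : nat := find (fun p => t < z p) (iota 0 n).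

Lemma rank_le z n t : (rank z n t <= n)%N.
Proof. by rewrite /rank -[leqRHS](size_iota 0) find_size. Qed.

Lemma rank_before z n t p : (p < rank z n t)%N -> z p <= t.
Proof.
move=> pr; have := before_find 0%N pr; rewrite nth_iota ?add0n; last first.
  exact: leq_trans (rank_le z n t).
by move/negbT; rewrite -leNgt.
Qed.

Lemma rank_at z n t : (rank z n t < n)%N -> t < z (rank z n t).
Proof.
move=> rn; have := @nth_find _ 0%N (fun p => t < z p) (iota 0 n).
by rewrite nth_iota // add0n; apply; rewrite has_find size_iota.
Qed.

Lemma rank_uniq z n t r : (r <= n)%N -> (forall p, (p < r)%N -> z p <= t) ->
  ((r < n)%N -> t < z r) -> rank z n t = r.
Proof.
move=> rn Hp Hr; apply/eqP; rewrite eqn_leq; apply/andP; split; rewrite leqNgt; apply/negP.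
  move=> lt; have rn' : (r < n)%N := leq_trans lt (rank_le z n t).
  by have := rank_before lt; rewrite leNgt Hr.
move=> lt; have := Hp _ lt; rewrite leNgt rank_at //; exact: leq_trans rn.
Qed.

Lemma rank_step z n t t' : {in gtn n &, {homo z : p q / (p < q)%N >-> p < q}} ->
  t < t' -> (forall p, (p < n)%N -> t < z p -> z p < t' -> False) ->
  (rank z n t' = rank z n t /\ forall p, (p < n)%N -> z p <> t') \/
  [/\ (rank z n t < n)%N, z (rank z n t) = t' & rank z n t' = (rank z n t).+1].
Proof.
move=> zmono tt' none; set r := rank z n t.
have before p : (p < r)%N -> z p < t' by move/rank_before => H; apply: le_lt_trans tt'.
case: (ltnP r n) => rn; last first.
  have rE : r = n by apply/eqP; rewrite eqn_leq rn rank_le.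
  left; split; last by move=> p pn E; have := before p; rewrite rE pn E ltxx => /(_ isT).
  by apply: rank_uniq => [|p /before /ltW //|]; rewrite rE // ltnn.
have := rank_at rn; rewrite -/r => tr.
have t'r : t' <= z r by rewrite leNgt; apply/negP; exact: none rn tr.
move: t'r; rewrite le_eqVlt => /orP[/eqP E|t'r].
  right; split => //; apply: rank_uniq => // [p|rn'].
    by rewrite ltnS leq_eqVlt => /orP[/eqP ->|/before/ltW //]; rewrite -E.
  by rewrite E; apply: zmono.
left; split; first by apply: rank_uniq => [|p /before /ltW|]; rewrite // ltnW.
move=> p pn; case: (ltngtP p r) => [/before /lt_eqF/eqP //|rp|->]; last first.
  by apply/eqP; rewrite gt_eqF.
have H : z r < z p by apply: zmono.
by move=> E; move: t'r; rewrite -E => /(lt_trans H); rewrite ltxx.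
Qed.

Section Profile.
Variables (h : nat -> nat -> R) (K : nat) (e : R).
Hypotheses (eK : e <= gap K / 8) (hh : hit_times K e h).

(** Hits and kicks of edge k alternate in time; even indices are hits. *)
Definition break k p : R := if odd p then kick h k.-1 p./2 else h k p./2.
Definition nbreak k : nat := ((nhit k).*2.-1)%N.
Definition slope k (t : R) : R := if odd (rank (break k) (nbreak k) t) then 1 else -1.
(** As the kicks are midpoints of consecutive hits, this is the distance of t to
    the set of hits of edge k. *)
Definition height k (t : R) : R := `|t - h k (rank (break k) (nbreak k) t)./2|.

Lemma nhit_gt0 k : (0 < k)%N -> (0 < nhit k)%N.
Proof.
elim: k => // k IH _ /=; case: ifP => // ok; rewrite double_gt0 IH //.
by case: k ok {IH}.
Qed.

Lemma break_hit k i : break k i.*2 = h k i.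
Proof. by rewrite /break odd_double doubleK. Qed.

Lemma break_mid k i : (0 < k <= K)%N -> (i.+1 < nhit k)%N ->
  h k i + h k i.+1 = 2 * break k i.*2.+1.
Proof.
case: k => // k kK iN; rewrite (hits_mid hh) // /break /= odd_double /= uphalf_double //.
Qed.

Lemma break_mono k : (0 < k <= K)%N ->
  {in gtn (nbreak k) &, {homo break k : p q / (p < q)%N >-> p < q}}.
Proof.
move=> /andP[k0 kK].
have step p : (p.+1 < nbreak k)%N -> break k p < break k p.+1.
  have g0 := gap_gt0 k; case op: (odd p) => pn.
    have [i pE] : exists i, p = i.*2.+1 by exists p./2; lia.
    subst p; have iN : (i.+1 < nhit k)%N by move: pn; rewrite /nbreak; lia.
    have := break_mid _ iN; rewrite k0 kK => /(_ isT) mid.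
    have := hits_mono eK hh kK (ltnSn i) iN.
    by rewrite -doubleS break_hit; move: mid; lra.
  have [i pE] : exists i, p = i.*2 by exists p./2; lia.
  subst p; have iN : (i.+1 < nhit k)%N by move: pn; rewrite /nbreak; lia.
  have := break_mid _ iN; rewrite k0 kK => /(_ isT) mid.
  have := hits_mono eK hh kK (ltnSn i) iN.
  by rewrite break_hit; move: mid; lra.
move=> p q _; rewrite inE; elim: q => // q IH qn; rewrite ltnS leq_eqVlt.
move=> /orP[/eqP -> |/IH H]; first exact: step.
by apply: lt_trans (step _ qn); apply: H; exact: ltnW.
Qed.

Lemma slopeP k t : slope k t = 1 \/ slope k t = -1.
Proof. by rewrite /slope; case: ifP; [left|right]. Qed.

Lemma height_gt0 k t : (0 < k)%N -> (forall i, (i < nhit k)%N -> h k i <> t) -> 0 < height k t.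
Proof.
move=> k0 H; rewrite /height normr_gt0 subr_eq0; apply/eqP => /esym; apply: H.
have := rank_le (break k) (nbreak k) t; have := nhit_gt0 k0; rewrite /nbreak; lia.
Qed.

Lemma height_slope k t : (0 < k <= K)%N ->
  height k t = slope k t * (t - h k (rank (break k) (nbreak k) t)./2).
Proof.
move=> kK; rewrite /height /slope.
have N0 : (0 < nhit k)%N by apply: nhit_gt0; case/andP: kK.
set r := rank _ _ _; have rn : (r <= nbreak k)%N := rank_le _ _ _.
case: ifP => o; rewrite ?mul1r ?mulN1r.
  rewrite ger0_norm // subr_ge0 -break_hit; apply: (@rank_before _ (nbreak k)).
  rewrite -/r; lia.
rewrite ler0_norm // subr_le0 ltW //.
have rlt : (r < nbreak k)%N by move: rn; rewrite /nbreak; lia.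
by have := rank_at rlt; rewrite -/r (_ : break k r = h k r./2) // /break o.
Qed.

(** Between consecutive events the clearance is affine, and at the end of such an
    interval the slope changes only at a hit or at a kick of the edge. *)
Lemma profile_step k t t' : (0 < k <= K)%N -> t < t' ->
  (forall p, (p < nbreak k)%N -> t < break k p -> break k p < t' -> False) ->
  height k t' = height k t + (t' - t) * slope k t /\
  [\/ slope k t' = slope k t /\ (forall p, (p < nbreak k)%N -> break k p <> t'),
      [/\ slope k t = -1, slope k t' = 1, height k t' = 0 &
          exists2 i, (i < nhit k)%N & h k i = t'] |
      [/\ slope k t = 1, slope k t' = -1 &
          exists2 i, (i.+1 < nhit k)%N & kick h k.-1 i = t']].
Proof.
move=> kK tt' none; rewrite !height_slope //.
have [[rE Hn]|[rn bE rE]] := rank_step (break_mono kK) tt' none.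
  by rewrite /slope rE; split; [ring | exact: Or31].
rewrite /slope rE; move: rn bE; set r := rank _ _ _ => rn bE; rewrite oddS.
case o: (odd r) => /=.
  have [i rI] : exists i, r = i.*2.+1 by exists r./2; lia.
  have iN : (i.+1 < nhit k)%N by move: rn; rewrite /nbreak; lia.
  have mid := break_mid kK iN.
  have -> : r./2 = i by lia.
  have -> : uphalf r = i.+1 by lia.
  rewrite rI in bE; split; first by move: mid; rewrite bE; lra.
  apply: Or33; split => //; exists i => //.
  by rewrite -bE /break /= odd_double /= uphalf_double.
have [i rI] : exists i, r = i.*2 by exists r./2; lia.
have iN : (i < nhit k)%N by move: rn; rewrite /nbreak; lia.
have -> : r./2 = i by lia.
have -> : uphalf r = i by lia.
rewrite rI break_hit in bE; rewrite bE; split; first by ring.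
by apply: Or32; split => //; [rewrite subrr mulr0 | exists i].
Qed.

Lemma slope_before k t : (0 < k <= K)%N ->
  (forall p, (p < nbreak k)%N -> t < break k p) -> slope k t = -1.
Proof. by move=> kK H; rewrite /slope (@rank_uniq _ _ _ 0%N) // => /H. Qed.

Lemma slope_after k t : (0 < k <= K)%N ->
  (forall p, (p < nbreak k)%N -> break k p <= t) -> slope k t = 1.
Proof.
move=> /andP[k0 kK] H; rewrite /slope (@rank_uniq _ _ _ (nbreak k)) ?ltnn //.
by have := nhit_gt0 k0; rewrite /nbreak; case: (odd _) / idP => //; lia.
Qed.

Definition events : seq R :=
  sort <=%O [seq h k i | k <- iota 0 K.+1, i <- iota 0 (nhit k)].

Lemma mem_events x :
  reflect (exists k i, [/\ (k <= K)%N, (i < nhit k)%N & h k i = x]) (x \in events).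
Proof.
rewrite mem_sort; apply: (iffP idP) => [/allpairsPdep|] [k [i]].
  by rewrite !mem_iota !add0n !leq0n /= => -[kK iN ->]; exists k, i.
move=> [kK iN <-]; apply/allpairsPdep; exists k, i.
by rewrite !mem_iota !add0n !leq0n.
Qed.

Lemma events_sorted : sorted <%O events.
Proof.
rewrite lt_sorted_uniq_le sort_le_sorted andbT sort_uniq.
apply: allpairs_uniq_dep => [||[k i] [k' i']]; rewrite ?iota_uniq //.
  by move=> k _; exact: iota_uniq.
move=> /allpairsPdep[a [b [Ha Hb [-> ->]]]] /allpairsPdep[c [d [Hc Hd [-> ->]]]] /= E.
move: Ha Hb Hc Hd; rewrite !mem_iota !add0n !leq0n /= => Ha Hb Hc Hd.
by have [-> ->] := hits_inj hh Ha Hc Hb Hd E.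
Qed.

(** Time 0 precedes all events; the m-th event, counted from 0, is [time m.+1]. *)
Definition time m : R := nth 0 (head 0 events - 1 :: events) m.

Lemma time_lt m m' : (m < m' <= size events)%N -> time m < time m'.
Proof.
move=> /andP[mm' m'M]; rewrite /time.
apply: (sorted_ltn_nth lt_trans) => //; rewrite ?inE /= ?ltnS //; last exact: ltnW (leq_trans mm' m'M).
have := events_sorted; case: events => //= a s ->; rewrite andbT; lra.
Qed.

Lemma time_event m : (m < size events)%N -> time m.+1 \in events.
Proof. by move=> mM; rewrite /time /= mem_nth. Qed.

Lemma event_time x : x \in events -> exists2 m, (m < size events)%N & x = time m.+1.
Proof. by move=> xe; exists (index x events); rewrite ?index_mem // /time /= nth_index. Qed.

Lemma time_le m m' : (m' <= size events)%N -> (time m < time m') -> (m <= size events)%N ->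
  (m < m')%N.
Proof.
move=> m'M tt mM; rewrite ltnNge; apply/negP; rewrite leq_eqVlt => /orP[/eqP E|lt].
  by move: tt; rewrite E ltxx.
by have := time_lt (m := m') (m' := m); rewrite lt mM => /(_ isT) /(lt_trans tt); rewrite ltxx.
Qed.

Lemma no_event m x : (m < size events)%N -> x \in events ->
  time m < x -> x < time m.+1 -> False.
Proof.
move=> mM /event_time[i iM ->] H1 H2.
have := time_le iM H1 (ltnW mM); have := time_le mM H2 iM; lia.
Qed.

Definition edge m : nat :=
  find (fun k => time m.+1 \in [seq h k i | i <- iota 0 (nhit k)]) (iota 0 K.+1).

Lemma edgeP m : (m < size events)%N ->
  (edge m <= K)%N /\ exists2 i, (i < nhit (edge m))%N & h (edge m) i = time m.+1.
Proof.
move=> /time_event/mem_events[k [i [kK iN E]]].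
have H : has (fun k => time m.+1 \in [seq h k i | i <- iota 0 (nhit k)]) (iota 0 K.+1).
  apply/hasP; exists k; first by rewrite mem_iota.
  by apply/mapP; exists i; rewrite // mem_iota.
have lt : (edge m < K.+1)%N by move: H; rewrite has_find size_iota.
split => //; have := nth_find 0%N H; rewrite -/(edge m) nth_iota // add0n.
by move=> /mapP[j]; rewrite mem_iota add0n => jN ->; exists j.
Qed.

Lemma edge_uniq m k i : (m < size events)%N -> (k <= K)%N -> (i < nhit k)%N ->
  h k i = time m.+1 -> k = edge m.
Proof.
move=> mM kK iN E; have [eK' [j jN E']] := edgeP mM.
by have [] := hits_inj hh kK eK' iN jN (etrans E (esym E')).
Qed.

Lemma kick_event k i : (0 < k <= K)%N -> (i.+1 < nhit k)%N ->
  exists k' i', [/\ kicks k' k, (k' <= K)%N, (i' < nhit k')%N & h k' i' = kick h k.-1 i].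
Proof.
case: k => // k kK iN; have [k' [i' [kk i'N E]]] := kick_hit iN.
by exists k', i'; split => //; move: kk; rewrite /kicks; lia.
Qed.

Lemma break_event k p : (0 < k <= K)%N -> (p < nbreak k)%N -> break k p \in events.
Proof.
move=> kK pn; apply/mem_events; rewrite /break; case op: (odd p).
  have [|k' [i' [_ H1 H2 E]]] := @kick_event k p./2 kK; last by exists k', i'.
  by move: pn; rewrite /nbreak; lia.
exists k, p./2; split => //; first by case/andP: kK.
by move: pn; rewrite /nbreak; lia.
Qed.

(** At each event all edges behave as [profile_step] says: the edge that is hit
    is unique by [hits_inj], so another edge changes slope exactly when the event
    is one of its kicks, that is, when it is kicked by the edge that is hit. *)
Lemma schedule_of_hits : schedule K (size events) time edge
  (fun m k => height k (time m)) (fun m k => slope k (time m)).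
Proof.
have step m k : (m < size events)%N -> (0 < k <= K)%N -> _ := fun mM kK =>
  profile_step kK (time_lt (m := m) (m' := m.+1) ltac:(by rewrite leqnn mM))
    (fun p pn => no_event mM (break_event kK pn)).
have first x : x \in events -> time 0 < x.
  by move=> /event_time[m mM ->]; apply: time_lt.
have irr k : kicks k k = false by rewrite /kicks; lia.
split.
- move=> k kK; split; first by apply: slope_before => // p /(break_event kK)/first.
  apply: height_gt0 => [|i iN E]; first by case/andP: kK.
  have /first : h k i \in events by apply/mem_events; exists k, i; case/andP: kK.
  by rewrite E ltxx.
- by move=> m mM; apply: time_lt; rewrite leqnn.
- move=> m mM; have [eM [i iN _]] := edgeP mM; rewrite eM andbT.
  by case: (edge m) iN.
- by move=> m k _ _; exact: slopeP.
- by move=> m k mM kK; have [] := step m k mM kK.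
- move=> m mM; have [eM [i iN E]] := edgeP mM.
  have kK : (0 < edge m <= K)%N by rewrite eM andbT; case: (edge m) iN.
  have [_ [[_ H]|[-> _ -> _] //|[_ _ [j jN Ej]]]] := step m _ mM kK.
    case: (H i.*2); last by rewrite break_hit.
    by move: iN; rewrite /nbreak; lia.
  have [k' [i' [kk k'K i'N E']]] := kick_event kK jN.
  have := edge_uniq mM k'K i'N (etrans E' Ej) => k'E.
  by move: kk; rewrite k'E irr.
- move=> m k mM kK /eqP ke; apply: height_gt0 => [|i iN E]; first by case/andP: kK.
  by apply: ke; apply: edge_uniq E => //; case/andP: kK.
- move=> m k mM kK; have [eM [i iN E]] := edgeP mM.
  have sE : slope (edge m) (time m) = -1.
    have kK' : (0 < edge m <= K)%N by rewrite eM andbT; case: (edge m) iN.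
    have [_ [[_ H]|[-> _ _ _] //|[_ _ [j jN Ej]]]] := step m _ mM kK'.
      case: (H i.*2); last by rewrite break_hit.
      by move: iN; rewrite /nbreak; lia.
    have [k' [i' [kk k'K i'N E']]] := kick_event kK' jN.
    have := edge_uniq mM k'K i'N (etrans E' Ej) => k'E.
    by move: kk; rewrite k'E irr.
  have kK' : (k <= K)%N by case/andP: kK.
  rewrite sE /response; have [_ [[-> H]|[-> -> _ [j jN Ej]]|[-> -> [j jN Ej]]]] := step m k mM kK.
  + case: eqP => [kE|_].
      case: (H i.*2); last by rewrite break_hit kE.
      by move: iN; rewrite -kE /nbreak; lia.
    case: ifP => kk; last by ring.
    case: k kK kK' H kk => // k kK kK' H kk.
    have [j jN Ej] := hit_kick kk iN.
    case: (H j.*2.+1); first by move: jN; rewrite /nbreak; lia.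
    by rewrite /break /= odd_double /= uphalf_double Ej.
  + by rewrite (edge_uniq mM kK' jN Ej) eqxx; ring.
  + have [k' [i' [kk k'K i'N E']]] := kick_event kK jN.
    have k'E := edge_uniq mM k'K i'N (etrans E' Ej).
    rewrite -k'E kk; case: eqP => [kE|_]; last by ring.
    by move: kk; rewrite kE irr.
- move=> k kK; apply: slope_after => // p /(break_event kK)/event_time[m mM ->].
  move: mM; rewrite leq_eqVlt => /orP[/eqP <- //|lt].
  by apply: ltW; apply: time_lt; rewrite lt leqnn.
Qed.

Lemma size_events : size events = (\sum_(k < K.+1) nhit k)%N.
Proof.
rewrite size_sort size_allpairs_dep sumnE big_map -(big_mkord xpredT nhit) /index_iota subn0.
by apply: eq_bigr => k _; rewrite size_iota.
Qed.

End Profile.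

Lemma nhit_even q : (2 ^ q.+1 <= nhit q.+1.*2)%N.
Proof.
elim: q => // q; rewrite [in X in _ -> X]doubleS.
by move: (q.+1) => p; rewrite /= odd_double /= expnS; lia.
Qed.

(** Two more edges double the number of hits of the last spine edge, which alone
    suffices for even K; for odd K the last leaf is counted as well. *)
Lemma sum_nhit K : (2 <= K)%N -> (2 ^ K.+1./2 <= \sum_(k < K.+1) nhit k)%N.
Proof.
move=> K2; have [q [] KE] : exists q, K = q.+1.*2 \/ K = q.+1.*2.+1.
  by exists (K./2.-1); lia.
  have -> : K.+1./2 = q.+1 by lia.
  rewrite KE big_ord_recr /=; apply: leq_trans (leq_addl _ _).
  exact: nhit_even.
have -> : K.+1./2 = q.+2 by lia.
have HS : nhit q.+1.*2.+1 = (nhit q.+1.*2).+1 by rewrite /= odd_double.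
move: HS (nhit_even q); rewrite KE; move: (q.+1.*2) nhit => d N HS H.
by rewrite 2!big_ord_recr /= HS expnS; lia.
Qed.

Lemma schedule_exists K : (2 <= K)%N -> exists M t ed y s,
  schedule K M t ed y s /\ (2 ^ K.+1./2 <= M)%N.
Proof.
move=> K2; have e0 : 0 < gap K / 8 by rewrite divr_gt0 // gap_gt0.
have [h hh] := hit_times_exist K e0.
do 5!eexists; split; first exact: schedule_of_hits (lexx _) hh.
by rewrite size_events sum_nhit.
Qed.
End HitTimes.

(** * Billiard trajectories from collision data *)

Section Billiard.
Variables (R : realType) (n d : nat).
Implicit Types (Q : 'M[R]_(n, d)) (k l : 'I_n).

Definition sqdist k l Q : R := dot (row k Q - row l Q) (row k Q - row l Q).

Lemma sqdistC k l Q : sqdist k l Q = sqdist l k Q.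
Proof. by rewrite /sqdist -opprB dotNl dotNr opprK. Qed.

Lemma on_wallE k l Q : on_wall k l Q <-> sqdist k l Q = 1.
Proof. exact: enorm_eq1. Qed.

Lemma dot_rows (A B : 'M[R]_(n, d)) : dot A B = \sum_k dot (row k A) (row k B).
Proof.
apply: eq_bigr => k _; rewrite /dot big_ord1.
by apply: eq_bigr => j _; rewrite !mxE.
Qed.

Lemma row_wall_normal k l x Q : k != l -> row x (wall_normal k l Q) =
  ((Num.sqrt 2)^-1 * ((x == k)%:R - (x == l)%:R)) *: (row k Q - row l Q).
Proof.
move=> kl; rewrite /wall_normal rowK; case: (eqVneq x k) => [->|xk].
  by rewrite (negbTE kl) subr0 mulr1.
case: (eqVneq x l) => _; last by rewrite subrr mulr0 scale0r.
by rewrite sub0r mulrN1 scaleNr -scalerN opprB.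
Qed.

Lemma dot_wall_normal k l Q A : k != l -> dot A (wall_normal k l Q) =
  (Num.sqrt 2)^-1 * dot (row k A - row l A) (row k Q - row l Q).
Proof.
move=> kl; rewrite dot_rows (bigD1 k) //= (bigD1 l) 1?eq_sym //= big1 => [|x /andP[xk xl]].
  rewrite !row_wall_normal // !eqxx (negbTE kl) eq_sym (negbTE kl).
  by rewrite dotBl !dotZr /=; ring.
by rewrite row_wall_normal // (negbTE xk) (negbTE xl) subrr mulr0 scale0r -(scale0r 0) dotZr mul0r.
Qed.

(** Reflection in a wall exchanges the components of the two velocities along the
    line of centers; when the balls touch, that line is spanned by a unit vector. *)
Lemma row_bounce k l x Q A : k != l ->
  row x (A - (2 * dot A (wall_normal k l Q)) *: wall_normal k l Q) =
  row x A - (dot (row k A - row l A) (row k Q - row l Q) * ((x == k)%:R - (x == l)%:R))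
    *: (row k Q - row l Q).
Proof.
move=> kl; rewrite linearB linearZ /= row_wall_normal // dot_wall_normal // scalerA.
congr (_ - _ *: _); set D := dot _ _; set p := _ - _.
have two : Num.sqrt 2 ^+ 2 = 2 :> R by rewrite sqr_sqrtr.
have n0 : Num.sqrt 2 != 0 :> R by rewrite sqrtr_eq0 -ltNge.
rewrite (_ : 2 * _ * _ = 2 / Num.sqrt 2 ^+ 2 * (D * p)); last by field.
by rewrite two divff // mul1r.
Qed.

(** The data of M successive collisions: from [T m] to [T m.+1] the configuration
    moves from [q m] with velocity [v m], and at [T m.+1] with m < M the balls
    [i m] and [j m] collide.  The last flight ends at [T M.+1] freely. *)
Record billiard M (T : nat -> R) (q v : nat -> 'M[R]_(n, d)) (i j : nat -> 'I_n) :
    Prop := Billiard {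
  bil_time : forall m, (m <= M)%N -> T m < T m.+1 ;
  bil_flight : forall m, (m < M)%N -> q m.+1 = q m + (T m.+1 - T m) *: v m ;
  bil_pair : forall m, (m < M)%N -> (i m < j m)%N ;
  bil_hit : forall m, (m < M)%N -> sqdist (i m) (j m) (q m.+1) = 1 ;
  bil_bounce : forall m, (m < M)%N ->
    v m.+1 = v m - (2 * dot (v m) (wall_normal (i m) (j m) (q m.+1)))
      *: wall_normal (i m) (j m) (q m.+1) ;
  bil_speed : forall m, (m < M)%N -> dot (v m) (wall_normal (i m) (j m) (q m.+1)) != 0 ;
  bil_miss : forall m k l, (m < M)%N -> (k < l)%N -> ~ (k = i m /\ l = j m) ->
    1 < sqdist k l (q m.+1) ;
  bil_apart : forall m t k l, (m <= M)%N -> T m < t < T m.+1 -> (k < l)%N ->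
    1 < sqdist k l (q m + (t - T m) *: v m) }.

Lemma linear_onS (J J' : set R) (g : R -> 'M[R]_(n, d)) :
  J `<=` J' -> linear_on J' g -> linear_on J g.
Proof. by move=> sJ [a [w H]]; exists a, w => s /sJ/H. Qed.

Lemma lderiv_linear (g : R -> 'M[R]_(n, d)) a t w : a < t ->
  (forall s, a <= s <= t -> g s = g a + (s - a) *: w) -> lderiv g t = w.
Proof.
move=> at_ H; rewrite /lderiv; apply: cvg_lim; first exact: norm_hausdorff.
apply: cvg_near_cst; near=> s.
have st : s < t by near: s; exact: nbhs_left_lt.
have as_ : a < s by near: s; exact: nbhs_left_gt.
rewrite (H s) ?(H t) ?lexx ?(ltW st) ?(ltW as_) ?(ltW at_) //.
rewrite opprD addrACA subrr add0r -scalerBl opprB addrA subrK scalerA mulVf ?scale1r //.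
by rewrite subr_eq0 lt_eqF.
Unshelve. all: by end_near. Qed.

Lemma rderiv_linear (g : R -> 'M[R]_(n, d)) t b w : t < b ->
  (forall s, t <= s <= b -> g s = g t + (s - t) *: w) -> rderiv g t = w.
Proof.
move=> tb H; rewrite /rderiv; apply: cvg_lim; first exact: norm_hausdorff.
apply: cvg_near_cst; near=> s.
have ts : t < s by near: s; exact: nbhs_right_gt.
have sb : s < b by near: s; exact: nbhs_right_lt.
rewrite (H s) ?(ltW ts) ?(ltW sb) // addrAC subrr add0r scalerA mulVf ?scale1r //.
by rewrite subr_eq0 gt_eqF.
Unshelve. all: by end_near. Qed.

Section Trajectory.
Variables (M : nat) (T : nat -> R) (q v : nat -> 'M[R]_(n, d)) (i j : nat -> 'I_n).
Hypothesis B : billiard M T q v i j.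

(** A sum of ramps, one for each jump of the velocity: continuity is then visible,
    and the pieces are recovered by [path_segment]. *)
Definition path t : 'M[R]_(n, d) :=
  q 0%N + (t - T 0%N) *: v 0%N
  + \sum_(m < M) Num.max 0 (t - T m.+1) *: (v m.+1 - v m).

Lemma time_mono a b : (a <= b <= M.+1)%N -> T a <= T b.
Proof.
move=> /andP[]; elim: b => [|b IH]; first by rewrite leqn0 => /eqP ->.
rewrite leq_eqVlt => /orP[/eqP -> //|ab] bM.
by apply: le_trans (IH ab (ltnW bM)) (ltW (bil_time B _)).
Qed.

Lemma time_succ_inj a b : (a < M)%N -> (b < M)%N -> T a.+1 = T b.+1 -> a = b.
Proof.
have lt x y : (x < y)%N -> (y < M)%N -> T x.+1 < T y.+1.
  move=> xy yM; apply: lt_le_trans (bil_time B (leq_trans xy (ltnW yM))) _.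
  by apply: time_mono; rewrite !ltnS xy ltnW.
move=> aM bM E; case: (ltngtP a b) => // H.
  by have := lt _ _ H bM; rewrite E ltxx.
by have := lt _ _ H aM; rewrite E ltxx.
Qed.

Lemma path_segment m t : (m <= M)%N -> T m <= t <= T m.+1 ->
  path t = q m + (t - T m) *: v m.
Proof.
move=> mM /andP[mt tm]; rewrite /path.
have -> : \sum_(p < M) Num.max 0 (t - T p.+1) *: (v p.+1 - v p) =
          \sum_(p < m) (t - T p.+1) *: (v p.+1 - v p).
  rewrite -(big_mkord xpredT (fun p => Num.max 0 (t - T p.+1) *: (v p.+1 - v p))).
  rewrite (big_cat_nat (n := m)) //= [X in _ + X = _]big1_seq ?addr0.
    rewrite big_mkord; apply: eq_bigr => p _; rewrite max_r // subr_ge0.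
    by apply: le_trans mt; apply: time_mono; rewrite ltn_ord ltnW.
  move=> p /andP[_]; rewrite mem_index_iota => /andP[mp pM].
  rewrite max_l ?scale0r // subr_le0.
  by apply: le_trans tm _; apply: time_mono; rewrite ltnS mp ltnS ltnW.
elim: m mM {mt tm} => [|m IH] mM; first by rewrite big_ord0 addr0.
rewrite big_ord_recr addrA IH ?(ltnW mM) // (bil_flight B) //.
by apply/matrixP => a b; rewrite !mxE; ring.
Qed.

Lemma path_break m : (m <= M)%N -> path (T m) = q m.
Proof.
move=> mM; rewrite (path_segment mM) ?subrr ?scale0r ?addr0 //.
by rewrite lexx ltW // (bil_time B).
Qed.

Lemma path_from m s : (m <= M)%N -> T m <= s <= T m.+1 ->
  path s = path (T m) + (s - T m) *: v m.
Proof. by move=> mM H; rewrite path_break // (path_segment mM H). Qed.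

Lemma path_linear m : (m <= M)%N -> linear_on `[T m, T m.+1] path.
Proof.
move=> mM; exists (q m - T m *: v m), (v m) => s /=; rewrite in_itv /= => H.
by rewrite (path_segment mM H) scalerBl -addrA [- _ + _]addrC.
Qed.

Lemma path_linear_near m t : (m <= M)%N -> T m < t < T m.+1 ->
  exists2 e, 0 < e & linear_on `[t - e, t + e] path.
Proof.
move=> mM /andP[mt tm].
exists (Num.min (t - T m) (T m.+1 - t)); first by rewrite lt_min !subr_gt0 mt.
have : t - Num.min (t - T m) (T m.+1 - t) >= T m.
  by rewrite lerBrDr addrC -lerBrDr ge_min lexx.
have : t + Num.min (t - T m) (T m.+1 - t) <= T m.+1.
  by rewrite -lerBrDl ge_min lexx orbT.
move: (Num.min _ _) => e e1 e2.
apply: linear_onS (path_linear mM) => s /=; rewrite !in_itv /= => /andP[? ?].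
by apply/andP; split; lra.
Qed.

Lemma path_continuous : continuous path.
Proof.
move=> t; apply: cvgD.
  by apply: cvgD; [exact: cvg_cst | apply: cvgZr_tmp; apply: cvgB; [exact: cvg_id | exact: cvg_cst]].
apply: cvg_sumr => m; apply: cvgZr_tmp.
apply: (@continuous_max _ _ (fun=> 0) (fun s => s - T m.+1)); first exact: cvg_cst.
by apply: cvgB; [exact: cvg_id | exact: cvg_cst].
Qed.

Lemma time_locate t : T 0%N < t < T M.+1 ->
  (exists2 m, (m <= M)%N & T m < t < T m.+1) \/ (exists2 m, (m < M)%N & t = T m.+1).
Proof.
move=> /andP[t0 tM].
have [m mM /andP[mt]] : exists2 m, (m <= M)%N & T m < t <= T m.+1.
  have : t <= T M.+1 by exact: ltW.
  have : (M <= M)%N by exact: leqnn.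
  elim: {1 3}M => [|m IH] mM tm; first by exists 0%N; rewrite ?t0 ?tm.
  case: (ltP (T m.+1) t) => mt; first by exists m.+1; rewrite ?mt.
  by apply: IH => //; exact: ltnW.
rewrite le_eqVlt => /orP[/eqP tE|tm]; last by left; exists m; rewrite ?mt.
right; exists m => //; rewrite ltn_neqAle mM andbT; apply/eqP => mE.
by move: tM; rewrite tE mE ltxx.
Qed.

Lemma wall_time t k l : T 0%N < t < T M.+1 -> (k < l)%N -> on_wall k l (path t) ->
  exists m, [/\ (m < M)%N, t = T m.+1, k = i m & l = j m].
Proof.
move=> tI kl /on_wallE W; have [[m mM tm]|[m mM tE]] := time_locate tI.
  have := bil_apart B mM tm kl; rewrite -(path_segment mM) ?W ?ltxx //.
  by case/andP: tm => /ltW -> /ltW ->.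
exists m; move: W; rewrite tE path_break // => W.
have [[-> ->] //|H] := pselect (k = i m /\ l = j m).
by have := bil_miss B mM kl H; rewrite W ltxx.
Qed.

Lemma lderiv_path m : (m < M)%N -> lderiv path (T m.+1) = v m.
Proof.
move=> mM; apply: (@lderiv_linear _ (T m)); first exact/(bil_time B)/ltnW.
by move=> s; apply: path_from; exact: ltnW.
Qed.

Lemma rderiv_path m : (m <= M)%N -> rderiv path (T m) = v m.
Proof.
move=> mM; apply: (@rderiv_linear _ _ (T m.+1)); first exact: bil_time B _ mM.
by move=> s; exact: path_from.
Qed.

(** The time interval is open, which leaves no endpoints to consider. *)
Lemma billiard_trajectory : trajectory `]T 0%N, T M.+1[ path.
Proof.
have Iint : (`]T 0%N, T M.+1[%classic : set R)° = `]T 0%N, T M.+1[%classic.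
  exact: interior_itv_bnd.
split.
- exact: interval_is_interval.
- exact: continuous_subspaceT path_continuous.
- move=> t /=; rewrite in_itv => /time_locate[[m mM tm]|[m mM ->]].
    have [e e0 He] := path_linear_near mM tm.
    by exists e => //; split; apply: linear_onS He => s /= [_]; rewrite !in_itv /= => /andP[? ?];
      apply/andP; split; lra.
  have a := bil_time B (ltnW mM); have b := bil_time B mM.
  exists (Num.min (T m.+1 - T m) (T m.+2 - T m.+1)); first by rewrite lt_min !subr_gt0 a.
  have : T m.+1 - Num.min (T m.+1 - T m) (T m.+2 - T m.+1) >= T m.
    by rewrite lerBrDr addrC -lerBrDr ge_min lexx.
  have : T m.+1 + Num.min (T m.+1 - T m) (T m.+2 - T m.+1) <= T m.+2.
    by rewrite -lerBrDl ge_min lexx orbT.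
  move: (Num.min _ _) => e e1 e2; split.
    apply: linear_onS (path_linear (ltnW mM)) => s /= [_].
    by rewrite !in_itv /= => /andP[? ?]; apply/andP; split; lra.
  apply: linear_onS (path_linear mM) => s /= [_].
  by rewrite !in_itv /= => /andP[? ?]; apply/andP; split; lra.
- move=> t /=; rewrite in_itv => tI.
  suff H k l : (k < l)%N -> 1 <= sqdist k l (path t).
    move=> k l; rewrite enorm_ge1 -/(sqdist k l _) neq_ltn => /orP[|lk]; first exact: H.
    by rewrite sqdistC; exact: H.
  move=> kl; have [[m mM tm]|[m mM ->]] := time_locate tI.
    have := bil_apart B mM tm kl; rewrite -(path_segment mM); first exact: ltW.
    by case/andP: tm => /ltW -> /ltW ->.
  rewrite path_break //.
  have [[-> ->]|H] := pselect (k = i m /\ l = j m); first by rewrite (bil_hit B).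
  exact: ltW (bil_miss B mM kl H).
- move=> t a b c e /=; rewrite in_itv => tI ab ce W1 W2.
  have [m [mM tE -> ->]] := wall_time tI ab W1.
  have [m' [mM' tE' -> ->]] := wall_time tI ce W2.
  by rewrite (time_succ_inj mM mM' (etrans (esym tE) tE')).
- move=> t /=; rewrite in_itv => tI noW.
  have [[m mM tm]|[m mM tE]] := time_locate tI; last first.
    case: (noW (i m) (j m)); first exact: bil_pair B _ mM.
    by apply/on_wallE; rewrite tE path_break // (bil_hit B).
  have [e e0 He] := path_linear_near mM tm.
  by exists e => //; apply: linear_onS He => s [].
- move=> t k l; rewrite Iint /= in_itv => tI kl W.
  have [m [mM -> -> ->]] := wall_time tI kl W.
  by rewrite lderiv_path // rderiv_path // path_break // -(bil_bounce B).
- by rewrite Iint => t [].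
Qed.

Lemma billiard_collision m : (m < M)%N -> collision `]T 0%N, T M.+1[ path (T m.+1).
Proof.
move=> mM.
have m1 : T 0%N <= T m by apply: time_mono; lia.
have m2 := bil_time B (ltnW mM).
have m3 : T m.+2 <= T M.+1 by apply: time_mono; lia.
have m4 := bil_time B mM.
split.
- by rewrite /= in_itv /=; apply/andP; split; lra.
- exists ((T m + T m.+1) / 2); last by lra.
  by rewrite /= in_itv /=; apply/andP; split; lra.
- exists (i m), (j m); split; first exact: bil_pair B _ mM.
    by apply/on_wallE; rewrite path_break // (bil_hit B).
  by rewrite lderiv_path // path_break // (bil_speed B).
Qed.

Lemma billiard_MaxCol : (M%:R%:E <= MaxCol R n d)%E.
Proof.
have [I [g [tr H]]] : exists (I : set R) (g : R -> 'M[R]_(n, d)), trajectory I g /\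
    (M%:R%:E <= counting (collision I g) :> \bar R)%E.
  exists `]T 0%N, T M.+1[%classic, path; split; first exact: billiard_trajectory.
  rewrite /counting; case: asboolP => fin; last exact: leey.
  rewrite lee_fin ler_nat.
  rewrite -{1}(size_iota 0 M) -(size_map (fun m => T m.+1)).
  apply: uniq_leq_size.
    rewrite map_inj_in_uniq ?iota_uniq // => x y; rewrite !mem_iota /= !add0n.
    exact: time_succ_inj.
  move=> x /mapP[m]; rewrite mem_iota /= add0n => mM ->.
  by rewrite in_fset_set // inE; exact: billiard_collision.
by apply: le_trans H _; apply: ereal_sup_ubound; exists I, g.
Qed.

End Trajectory.
End Billiard.

(** * Limits as the parameter decreases to zero *)

Section Tends.
Variable R : realType.
Implicit Types V : normedModType R.

(** Convergence is wrapped in an inductive proposition because its unfolding is a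
    quantified statement, into which unification and the computation of implicit
    arguments would look. *)
Variant tends V (f : R -> V) (l : V) : Prop := Tends of f x @[x --> 0^'+] --> l.

Lemma tends_eq V (f : R -> V) l l' : tends f l -> l = l' -> tends f l'.
Proof. by move=> fl <-. Qed.

Lemma tends_cst V (l : V) : tends (fun=> l) l.
Proof. by constructor; exact: cvg_cst. Qed.

Lemma tendsD V (f g : R -> V) a b :
  tends f a -> tends g b -> tends (fun x => f x + g x) (a + b).
Proof. by move=> [fa] [gb]; constructor; exact: cvgD. Qed.

Lemma tendsN V (f : R -> V) a : tends f a -> tends (fun x => - f x) (- a).
Proof. by move=> [fa]; constructor; exact: cvgN. Qed.

Lemma tendsB V (f g : R -> V) a b :
  tends f a -> tends g b -> tends (fun x => f x - g x) (a - b).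
Proof. by move=> fa gb; apply: tendsD => //; exact: tendsN. Qed.

Lemma tendsZ V (c : R -> R) (f : R -> V) k a :
  tends c k -> tends f a -> tends (fun x => c x *: f x) (k *: a).
Proof. by move=> [fa] [gb]; constructor; exact: cvgZ. Qed.

Lemma tendsM (f g : R -> R) a b :
  tends f a -> tends g b -> tends (fun x => f x * g x) (a * b).
Proof. by move=> [fa] [gb]; constructor; exact: cvgM. Qed.

Lemma tendsV (f : R -> R) a : a != 0 -> tends f a -> tends (fun x => (f x)^-1) a^-1.
Proof. by move=> a0 [fa]; constructor; exact: cvgV. Qed.

Lemma tendsX (f : R -> R) a n : tends f a -> tends (fun x => f x ^+ n) (a ^+ n).
Proof.
move=> fa; elim: n => [|n IH]; first exact: tends_cst.
by rewrite exprS; under eq_fun do rewrite exprS; apply: tendsM.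
Qed.

Lemma tends_id : tends (fun x : R => x) 0.
Proof. by constructor; apply: cvg_at_right_filter; exact: cvg_id. Qed.

Lemma tends_sqrt (f : R -> R) a : tends f a -> tends (fun x => Num.sqrt (f x)) (Num.sqrt a).
Proof.
by move=> [fa]; constructor; apply: continuous_cvg => //; exact: sqrt_continuous.
Qed.

Lemma tends_sum V (I : Type) (r : seq I) (f : I -> R -> V) (a : I -> V) :
  (forall i, tends (f i) (a i)) ->
  tends (fun x => \sum_(i <- r) f i x) (\sum_(i <- r) a i).
Proof. by move=> fa; constructor; apply: cvg_sumr => i; case: (fa i). Qed.

Lemma tends_dot m k (f g : R -> 'M[R]_(m, k)) a b :
  tends f a -> tends g b -> tends (fun x => dot (f x) (g x)) (dot a b).
Proof.
have tends_coord (h : R -> 'M[R]_(m, k)) c i j : tends h c -> tends (fun x => h x i j) (c i j).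
  move=> [hc]; constructor.
  exact: (cvg_comp h (fun A : 'M[R]_(m, k) => A i j) hc (@coord_continuous R m k i j c)).
by move=> fa gb; apply: tends_sum => i; apply: tends_sum => j; apply: tendsM; exact: tends_coord.
Qed.

Lemma tends_near (f g : R -> R) (l : R) :
  (forall x : R, 0 < x -> f x = g x) -> tends f l -> tends g l.
Proof.
move=> fg [fl]; constructor; apply: cvg_trans fl; apply: near_eq_cvg; near=> x.
by rewrite fg //; near: x; exact: nbhs_right_gt.
Unshelve. all: by end_near. Qed.

Lemma tends_lt (f : R -> R) l c : tends f l -> l < c -> \forall x \near 0^'+, f x < c.
Proof. by move=> [fl] lc; exact: (cvgr_lt l fl). Qed.

Lemma tends_gt (f : R -> R) l c : tends f l -> c < l -> \forall x \near 0^'+, c < f x.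
Proof. by move=> [fl] lc; exact: (cvgr_gt l fl). Qed.

End Tends.

(** * Directions of the contacts *)

Section Geometry.
Variable R : realType.
Notation V := 'rV[R]_3.
Implicit Types (a f g c d v w x y : V) (t : R) (q k : nat).

Definition orthonormal a f g : Prop :=
  [/\ dot a a = 1, dot f f = 1 & dot g g = 1] /\
  [/\ dot a f = 0, dot a g = 0 & dot f g = 0].

(** Given an orthonormal frame F at a spine ball whose first vector points to the
    parent ball, [leaf] and [spine] are the directions of its two other contacts.
    They are inverse stereographic images of points near the origin, which makes
    them exact unit vectors with rational coordinates; the points are chosen so
    that the inner products with the parent direction and with each other are
    asymptotic to -2t, -2t^2 and -2t. *)
Definition leaf t (F : V * V * V) : V :=
  (1 + t ^+ 2)^-1 *: (- (2 * t) *: F.1.1 + (1 - t ^+ 2) *: F.1.2).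

Definition spine t (F : V * V * V) : V :=
  (1 + t ^+ 2 + t ^+ 4)^-1 *:
  (- (2 * t ^+ 2) *: F.1.1 - (2 * t) *: F.1.2 + (1 - t ^+ 2 - t ^+ 4) *: F.2).

Definition reflect w x : V := x - (2 * dot x w / dot w w) *: w.

(** The frame at the next spine ball.  The hyperplane reflection that exchanges the
    parent direction with the opposite of the spine direction carries the frame
    to an orthonormal one whose first vector points back, as required.  The sign
    of the second vector makes leaves of successive spine balls lie on opposite
    sides, so that they do not touch. *)
Definition turn t (F : V * V * V) : V * V * V :=
  let r := reflect (F.1.1 + spine t F) in (r F.1.1, - r F.1.2, r F.2).

Definition axis (i : nat) : V := \row_j ((j : nat) == i)%:R.

Definition frame t q : V * V * V :=
  iter q (turn t) (- axis 0, axis 2, axis 1).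

(** The unit vector from ball [par k] to ball k. *)
Definition dir t k : V :=
  if odd k then leaf t (frame t k./2) else spine t (frame t k.-1./2).

Lemma dot_axis i j : (i < 3)%N -> dot (axis i) (axis j) = (i == j)%:R.
Proof.
move=> i3; rewrite /dot big_ord1 (bigD1 (Ordinal i3)) //= big1 ?addr0 => [|k ki].
  by rewrite !mxE !eqxx mul1r.
rewrite !mxE; case: eqP => [kE|]; last by rewrite mul0r.
by case/eqP: ki; exact: val_inj.
Qed.

Lemma dot_reflect w x y : dot w w != 0 -> dot (reflect w x) (reflect w y) = dot x y.
Proof. by move=> w0; rewrite /reflect !dotE (dotC w y); field. Qed.

Lemma sqr1 t : 1 + t ^+ 2 != 0.
Proof. by rewrite gt_eqF // ltr_pwDl // sqr_ge0. Qed.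

Lemma sqr2 t : 1 + t ^+ 2 + t ^+ 4 != 0.
Proof. by rewrite gt_eqF // -addrA ltr_pwDl // addr_ge0 ?sqr_ge0 // exprn_even_ge0. Qed.

Section Frame.
Variables (t : R) (F : V * V * V).
Hypothesis oF : orthonormal F.1.1 F.1.2 F.2.

Lemma dot_leaf : dot (leaf t F) (leaf t F) = 1.
Proof.
have [[aa ff gg] [af ag fg]] := oF.
rewrite /leaf !dotE aa ff (dotC F.1.2) af; field; exact: sqr1.
Qed.

Lemma dot_spine : dot (spine t F) (spine t F) = 1.
Proof.
have [[aa ff gg] [af ag fg]] := oF.
rewrite /spine !dotE aa ff gg (dotC F.1.2 F.1.1) !(dotC F.2) af ag fg; field; exact: sqr2.
Qed.

Lemma dot_leaf_spine : dot (leaf t F) (spine t F) =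
  t * (- 2 + 6 * t ^+ 2) / ((1 + t ^+ 2) * (1 + t ^+ 2 + t ^+ 4)).
Proof.
have [[aa ff gg] [af ag fg]] := oF.
rewrite /leaf /spine !dotE aa ff (dotC F.1.2 F.1.1) af ag fg; field.
by rewrite sqr1 sqr2.
Qed.

Lemma dot_parent_leaf : dot F.1.1 (leaf t F) = - (2 * t) / (1 + t ^+ 2).
Proof. by have [[aa _ _] [af _ _]] := oF; rewrite /leaf !dotE aa af; field; exact: sqr1. Qed.

Lemma dot_parent_spine : dot F.1.1 (spine t F) = - (2 * t ^+ 2) / (1 + t ^+ 2 + t ^+ 4).
Proof.
by have [[aa _ _] [af ag _]] := oF; rewrite /spine !dotE aa af ag; field; exact: sqr2.
Qed.

Lemma turn_axis : dot (F.1.1 + spine t F) (F.1.1 + spine t F) =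
  2 * (1 - t ^+ 2 + t ^+ 4) / (1 + t ^+ 2 + t ^+ 4).
Proof.
rewrite dotDl !dotDr dot_spine (dotC (spine _ _)) dot_parent_spine.
have [[-> _ _] _] := oF; field; exact: sqr2.
Qed.

Lemma turn_axis_neq0 : dot (F.1.1 + spine t F) (F.1.1 + spine t F) != 0.
Proof.
rewrite turn_axis mulf_neq0 ?invr_neq0 ?sqr2 // mulf_neq0 // gt_eqF //.
have := sqr_ge0 (t ^+ 2 - 2^-1); rewrite (_ : t ^+ 4 = (t ^+ 2) ^+ 2); first nra.
by rewrite -exprM.
Qed.

Lemma turn_orthonormal :
  orthonormal (turn t F).1.1 (turn t F).1.2 (turn t F).2.
Proof.
have [[aa ff gg] [af ag fg]] := oF; have w0 := turn_axis_neq0.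
by rewrite /turn; split; split; rewrite /= ?dotNl ?dotNr ?opprK dot_reflect // ?af ?fg ?oppr0.
Qed.

Lemma turn_parent : (turn t F).1.1 = - spine t F.
Proof.
rewrite /turn /reflect /= (_ : 2 * _ / _ = 1); first by rewrite scale1r opprD addNKr.
rewrite turn_axis dotDr dot_parent_spine; have [[-> _ _] _] := oF; field.
rewrite sqr2 gt_eqF //=.
have := sqr_ge0 (t ^+ 2 - 2^-1); rewrite (_ : t ^+ 4 = (t ^+ 2) ^+ 2); first nra.
by rewrite -exprM.
Qed.

End Frame.

Lemma frame_orthonormal t q :
  orthonormal (frame t q).1.1 (frame t q).1.2 (frame t q).2.
Proof.
elim: q => [|q IH]; last exact: turn_orthonormal.
by split; split; rewrite /= ?dotNl ?dotNr ?opprK dot_axis // oppr0.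
Qed.

Lemma dir_leaf t q : dir t q.*2.+1 = leaf t (frame t q).
Proof. by rewrite /dir /= odd_double /= uphalf_double. Qed.

Lemma dir_spine t q : dir t q.*2.+2 = spine t (frame t q).
Proof. by rewrite /dir /= odd_double /= uphalf_double. Qed.

Lemma frame_parent t q : (frame t q.+1).1.1 = - dir t q.*2.+2.
Proof. by rewrite dir_spine -turn_parent //; exact: frame_orthonormal. Qed.

Lemma dot_dir t k : (0 < k)%N -> dot (dir t k) (dir t k) = 1.
Proof.
case: k => // k _; case ok: (odd k).
  have -> : k = k./2.*2.+1 by lia.
  by rewrite dir_spine dot_spine //; exact: frame_orthonormal.
have -> : k = k./2.*2 by lia.
by rewrite dir_leaf dot_leaf //; exact: frame_orthonormal.
Qed.

Lemma tends_frame q : [/\ tends (fun t => (frame t q).1.1) (frame 0 q).1.1,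
   tends (fun t => (frame t q).1.2) (frame 0 q).1.2 &
   tends (fun t => (frame t q).2) (frame 0 q).2].
Proof.
elim: q => [|q [Ha Hf Hg]]; first by split; exact: tends_cst.
have tI := @tends_id R.
have tX n : tends (fun t : R => t ^+ n) (0 ^+ n) by exact: tendsX.
have Hs : tends (fun t => spine t (frame t q)) (spine 0 (frame 0 q)).
  apply: tendsZ.
    apply: tendsV; first exact: sqr2.
    by apply: tendsD => //; apply: tendsD => //; exact: tends_cst.
  apply: tendsD.
    apply: tendsB; apply: tendsZ => //.
      by apply: tendsN; apply: tendsM => //; exact: tends_cst.
    by apply: tendsM => //; exact: tends_cst.
  by apply: tendsZ => //; apply: tendsB => //; apply: tendsB => //; exact: tends_cst.
have Hw := tendsD Ha Hs.
have Hr (e : R -> V) e0 : tends e e0 ->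
    tends (fun t => reflect ((frame t q).1.1 + spine t (frame t q)) (e t))
          (reflect ((frame 0 q).1.1 + spine 0 (frame 0 q)) e0).
  move=> He; apply: tendsB => //; apply: tendsZ => //; apply: tendsM.
    by apply: tendsM; [exact: tends_cst | exact: tends_dot].
  apply: tendsV; last exact: tends_dot.
  by apply: turn_axis_neq0; exact: frame_orthonormal.
by split; [exact: Hr | apply: tendsN; exact: Hr | exact: Hr].
Qed.

Lemma tends_dir k : tends (dir ^~ k) (dir 0 k).
Proof.
have tX n : tends (fun t : R => t ^+ n) (0 ^+ n) by apply: tendsX; exact: tends_id.
rewrite /dir; case: (odd k).
  have [Ha Hf Hg] := tends_frame k./2.
  apply: tendsZ.
    by apply: tendsV; [exact: sqr1 | apply: tendsD => //; exact: tends_cst].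
  apply: tendsD; apply: tendsZ => //; last by apply: tendsB => //; exact: tends_cst.
  by apply: tendsN; apply: tendsM; [exact: tends_cst | exact: tends_id].
have [Ha Hf Hg] := tends_frame k.-1./2.
apply: tendsZ.
  apply: tendsV; first exact: sqr2.
  by apply: tendsD => //; apply: tendsD => //; exact: tends_cst.
apply: tendsD.
  apply: tendsB; apply: tendsZ => //.
    by apply: tendsN; apply: tendsM => //; exact: tends_cst.
  by apply: tendsM; [exact: tends_cst | exact: tends_id].
by apply: tendsZ => //; apply: tendsB => //; apply: tendsB => //; exact: tends_cst.
Qed.

(** At t = 0 the spine is a staircase in a coordinate plane and each step has inner
    product 1 with [diag], while leaves are parallel to [vert]; these two
    functionals separate balls that do not touch. *)
Definition diag : V := axis 0 + axis 1.
Definition vert : V := axis 2.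

Lemma leaf0 F : leaf 0 F = F.1.2.
Proof. by rewrite /leaf mulr0 oppr0 scale0r add0r expr0n /= subr0 addr0 invr1 !scale1r. Qed.

Lemma spine0 F : spine 0 F = F.2.
Proof.
by rewrite /spine !expr0n /= !mulr0 oppr0 !scale0r !subr0 !addr0 invr1 !scale1r add0r.
Qed.

Lemma turn0 (F : V * V * V) : orthonormal F.1.1 F.1.2 F.2 ->
  turn 0 F = (- F.2, - F.1.2, - F.1.1).
Proof.
move=> [[aa ff gg] [af ag fg]]; rewrite /turn /reflect spine0 /=.
have -> : dot (F.1.1 + F.2) (F.1.1 + F.2) = 2.
  by rewrite !(dotDl, dotDr) aa gg (dotC F.2) ag; ring.
congr (_, _, _).
- by rewrite dotDr aa ag (_ : _ / _ = 1) ?scale1r ?opprD ?addNKr //; field.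
- by rewrite dotDr fg (dotC F.1.2) af addr0 mulr0 mul0r scale0r subr0.
- rewrite dotDr gg (dotC F.2) ag (_ : _ / _ = 1); last by field.
  by rewrite scale1r opprD [- _ - _]addrC addNKr.
Qed.

Lemma frame0 q : [/\ dot (frame 0 q).1.1 diag = -1, dot (frame 0 q).1.2 diag = 0 &
    dot (frame 0 q).2 diag = 1] /\ [/\ dot (frame 0 q).1.1 vert = 0,
    dot (frame 0 q).1.2 vert = (-1) ^+ q & dot (frame 0 q).2 vert = 0].
Proof.
elim: q => [|q [[ad fd gd] [av fv gv]]].
  by rewrite /= /diag /vert; split; split; rewrite ?dotE !dot_axis //= ?addr0 ?add0r ?oppr0.
rewrite [frame 0 q.+1]iterS -/(frame 0 q) turn0; last exact: frame_orthonormal.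
rewrite [fst _]/= [snd _]/= !dotNl ad fd gd av fv gv exprS oppr0 opprK.
by split; split => //; ring.
Qed.

(** Bessel's inequality for the orthogonal vectors d, of square norm 2, and v. *)
Lemma bessel2 x d v : dot d d = 2 -> dot d v = 0 -> dot v v = 1 ->
  dot x d ^+ 2 / 2 + dot x v ^+ 2 <= dot x x.
Proof.
move=> dd dv vv; have := dot_ge0 (x - (dot x d / 2) *: d - dot x v *: v).
by rewrite !dotE dd vv (dotC v d) dv (dotC d x) (dotC v x); nra.
Qed.

Lemma norm_ge_diag_vert x : dot x diag ^+ 2 / 2 + dot x vert ^+ 2 <= dot x x.
Proof.
apply: bessel2; rewrite /diag /vert ?dotDl ?dotDr !dot_axis //=; ring.
Qed.

End Geometry.

(** * The caterpillar of balls *)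

Definition par k : nat := (k.-1)./2.*2.

Lemma par_lt k : (0 < k)%N -> (par k < k)%N. Proof. by rewrite /par; lia. Qed.

Section Layout.
Variable R : realType.
Notation V := 'rV[R]_3.

(** The vector attached to ball x when [d k] is the difference between the vectors
    attached to balls k and [par k], and ball 0 is at the origin. *)
Definition place (d : nat -> V) x : V :=
  \sum_(p < x./2) d p.*2.+2 + (if odd x then d x else 0).

Lemma place_even d p : place d p.*2 = \sum_(r < p) d r.*2.+2.
Proof. by rewrite /place doubleK odd_double addr0. Qed.

Lemma place_odd d p : place d p.*2.+1 = place d p.*2 + d p.*2.+1.
Proof. by rewrite place_even /place /= odd_double uphalf_double. Qed.

Lemma place_par d k : (0 < k)%N -> place d k - place d (par k) = d k.
Proof.
move=> k0; have [p [] kE] : exists p, k = p.*2.+1 \/ k = p.*2.+2.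
  by exists k.-1./2; lia.
- have -> : par k = p.*2 by rewrite /par; lia.
  by rewrite kE place_odd addrAC subrr add0r.
- have -> : par k = p.*2 by rewrite /par; lia.
  by rewrite kE -doubleS !place_even big_ord_recr addrAC subrr add0r.
Qed.

Lemma tends_place (d : R -> nat -> V) d0 x : (forall k, tends (d ^~ k) (d0 k)) ->
  tends (fun t => place (d t) x) (place d0 x).
Proof.
move=> H; apply: tendsD; first by apply: tends_sum => p.
by case: ifP => _; [exact: H | exact: tends_cst].
Qed.

Definition base (t : R) : nat -> V := place (dir t).

Lemma base_diag x : dot (base 0 x) (diag R) = x./2%:R.
Proof.
have sumE n : dot (\sum_(p < n) dir (0 : R) p.*2.+2) (diag R) = n%:R.
  elim: n => [|n IH]; first by rewrite big_ord0 -(scale0r 0) dotZl mul0r.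
  have [[_ _ g] _] := frame0 R n.
  by rewrite big_ord_recr dotDl IH /= dir_spine spine0 g natr1.
rewrite /base /place dotDl sumE; case: ifP => ox; last by rewrite -(scale0r 0) dotZl mul0r addr0.
have {2}-> : x = x./2.*2.+1 by lia.
by rewrite dir_leaf leaf0; have [[_ -> _] _] := frame0 R x./2; rewrite addr0.
Qed.

Lemma base_vert x : dot (base 0 x) (vert R) = if odd x then (-1) ^+ x./2 else 0.
Proof.
have sumE n : dot (\sum_(p < n) dir (0 : R) p.*2.+2) (vert R) = 0.
  elim: n => [|n IH]; first by rewrite big_ord0 -(scale0r 0) dotZl mul0r.
  have [_ [_ _ g]] := frame0 R n.
  by rewrite big_ord_recr dotDl IH /= dir_spine spine0 g addr0.
rewrite /base /place dotDl sumE add0r; case: ifP => ox; last by rewrite -(scale0r 0) dotZl mul0r.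
have {1}-> : x = x./2.*2.+1 by lia.
by rewrite dir_leaf leaf0; have [_ [_ -> _]] := frame0 R x./2.
Qed.

(** Any bound larger than 1 would do: it leaves room for small perturbations. *)
Lemma base_far x y : (x < y)%N -> x <> par y ->
  3 / 2 <= dot (base 0 x - base 0 y) (base 0 x - base 0 y).
Proof.
move=> xy xp; apply: le_trans (norm_ge_diag_vert _).
rewrite !dotBl !base_diag !base_vert.
have [r [rE rx]] : exists r, y./2 = (x./2 + r)%N /\ (0 < r)%N.
  exists (y./2 - x./2)%N; move: xp; rewrite /par; lia.
rewrite rE natrD opprD addNKr sqrrN.
have [r2|r1] := ltnP 1 r.
  have : (2 : R) <= r%:R by rewrite (ler_nat R 2).
  by set z := (X in _ + X ^+ 2) => ?; have := sqr_ge0 z; nra.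
have {r1}r1 : r = 1%N by lia.
rewrite r1; have sq n : ((-1 : R) ^+ n) ^+ 2 = 1 by rewrite -exprM mulnC exprM sqrrN expr1n expr1n.
have [[ox oy]|[[ox oy]|[ox oy]]] : (odd x /\ odd y) \/ (odd x /\ ~~ odd y) \/ (~~ odd x /\ odd y).
  by move: xp; rewrite /par; case: (odd x) / idP; case: (odd y) / idP; try lia; tauto.
- by rewrite ox oy exprD expr1; have := sq x./2; lra.
- by rewrite ox (negbTE oy) subr0 sq; lra.
- by rewrite (negbTE ox) oy sub0r sqrrN sq; lra.
Qed.

(** In a collision on edge k the balls k and [par k] receive opposite impulses. *)
Definition push k x : R := (x == par k)%:R - (x == k)%:R.

(** The directions are chosen for this limit.  The first factor gives the sign with
    which a collision on edge k acts on edge l, and vanishes unless the edges share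
    a ball; the ratio of scales turns the inner product of order t^|l-k| into 2 or
    -2 when l is slower than k, and makes it negligible when l is faster. *)
Lemma tends_coupling k l : (0 < k)%N -> (0 < l)%N ->
  tends (fun t => (push k l - push k (par l)) * (t ^+ k / t ^+ l * dot (dir t k) (dir t l)))
    (response R k l).
Proof.
move=> k0 l0; rewrite /response.
have tX n : tends (fun t : R => t ^+ n) (0 ^+ n) by apply: tendsX; exact: tends_id.
have fast : (l < k)%N ->
    tends (fun t : R => t ^+ k / t ^+ l * dot (dir t k) (dir t l)) 0.
  move=> lk; refine (tends_near (f := fun t : R => t ^+ (k - l) * dot (dir t k) (dir t l)) _ _).
    by move=> t t0; rewrite -{3}(subnK (ltnW lk)) exprD mulfK // expf_neq0 // gt_eqF.
  refine (tends_eq (tendsM (tX (k - l)%N) (tends_dot (tends_dir R k) (tends_dir R l))) _).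
  by rewrite expr0n gtn_eqF ?subn_gt0 // mul0r.
case: eqP => [->|/eqP lk].
  have -> : push k k - push k (par k) = -2.
    rewrite /push !eqxx; have -> : (k == par k) = false by rewrite /par; lia.
    have -> : (par k == k) = false by rewrite /par; lia.
    by rewrite /=; ring.
  refine (tends_near (f := fun=> -2) _ _) => [t t0|]; last exact: tends_cst.
  by rewrite dot_dir // divff ?mulr1 // expf_neq0 // gt_eqF.
case: ifP => kk; last first.
  have [lt|ge] := ltnP l k.
    by refine (tends_eq (tendsM (tends_cst _) (fast lt)) _); rewrite mulr0.
  have -> : push k l - push k (par l) = 0.
    rewrite /push; have -> : (l == par k) = false by move: ge; rewrite /par; lia.
    have -> : (par l == par k) = false by move: kk lk; rewrite /kicks /par; lia.
    have -> : (par l == k) = false by move: kk lk; rewrite /kicks /par; lia.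
    by rewrite (negbTE lk) /=; ring.
  by under eq_fun do rewrite mul0r; exact: tends_cst.
have tends_inv (f : R -> R) : tends f 1 -> tends (fun t => 2 / f t) 2.
  move=> H; refine (tends_eq (tendsM (tends_cst _) (tendsV _ H)) _); first exact: oner_neq0.
  by rewrite invr1 mulr1.
have N2 : tends (fun t : R => 1 + t ^+ 2) 1.
  by refine (tends_eq (tendsD (tends_cst _) (tX 2%N)) _); rewrite expr0n addr0.
have N4 : tends (fun t : R => 1 + t ^+ 2 + t ^+ 4) 1.
  by refine (tends_eq (tendsD N2 (tX 4%N)) _); rewrite expr0n addr0.
case ok: (odd k).
  have [p kE] : exists p, k = p.*2.+1 by exists k./2; lia.
  have lE : l = p.*2.+2 by move: kk; rewrite /kicks ok; lia.
  have -> : push k l - push k (par l) = -1.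
    rewrite /push; have -> : (l == par k) = false by rewrite /par; lia.
    have -> : (par l == par k) by rewrite /par; lia.
    have -> : (par l == k) = false by rewrite /par; lia.
    by rewrite (negbTE lk) /=; ring.
  refine (tends_near (f := fun t : R => (2 - 6 * t ^+ 2) / ((1 + t ^+ 2) * (1 + t ^+ 2 + t ^+ 4))) _ _)
    => [t t0|].
    have t0' : t != 0 by rewrite gt_eqF.
    rewrite kE lE dir_leaf dir_spine dot_leaf_spine; last exact: frame_orthonormal.
    rewrite [t ^+ p.*2.+2]exprS; move: (t ^+ p.*2.+1) (expf_neq0 p.*2.+1 t0') => z z0.
    by field; rewrite z0 t0' sqr1 sqr2.
  apply: tends_eq.
    apply: tendsM; first by apply: tendsB (tends_cst _) (tendsM (tends_cst _) (tX 2%N)).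
    by apply: tendsV (tendsM N2 N4); rewrite mulr1 oner_neq0.
  by rewrite expr0n /= mulr0 subr0 mulr1 invr1 mulr1.
have [p kE] : exists p, k = p.*2.+2 by exists k.-1./2; lia.
have -> : push k l - push k (par l) = 1.
  rewrite /push; have -> : (l == par k) = false by move: kk; rewrite /kicks /par; lia.
  have -> : (par l == par k) = false by move: kk; rewrite /kicks /par; lia.
  have -> : (par l == k) by move: kk; rewrite /kicks /par; lia.
  by rewrite (negbTE lk) /=; ring.
have dE t : dir t k = - (frame t p.+1).1.1 by rewrite kE frame_parent opprK.
have [lE|lE] : l = k.+1 \/ l = k.+2 by move: kk; rewrite /kicks; lia.
  refine (tends_near (f := fun t : R => 2 / (1 + t ^+ 2)) _ _) => [t t0|]; last exact: tends_inv N2.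
  rewrite dE lE (_ : k.+1 = p.+1.*2.+1) ?dir_leaf; last by lia.
  rewrite dotNl dot_parent_leaf ?kE; last exact: frame_orthonormal.
  have t0' : t != 0 by rewrite gt_eqF.
  rewrite -doubleS [t ^+ p.+1.*2.+1]exprS; move: (t ^+ p.+1.*2) (expf_neq0 p.+1.*2 t0') => z z0.
  by field; rewrite z0 t0' sqr1.
refine (tends_near (f := fun t : R => 2 / (1 + t ^+ 2 + t ^+ 4)) _ _) => [t t0|]; last exact: tends_inv N4.
rewrite dE lE (_ : k.+2 = p.+1.*2.+2) ?dir_spine; last by lia.
rewrite dotNl dot_parent_spine ?kE; last exact: frame_orthonormal.
have t0' : t != 0 by rewrite gt_eqF.
rewrite -!doubleS (_ : t ^+ p.+2.*2 = t * (t * t ^+ p.+1.*2)); last first.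
  by rewrite [p.+2.*2]doubleS !exprS.
move: (t ^+ p.+1.*2) (expf_neq0 p.+1.*2 t0') => z z0.
by field; rewrite z0 t0' sqr2.
Qed.

End Layout.

(** * Exact motion of the balls and its limit *)

Section Simulation.
Variables (R : realType) (K M : nat) (time : nat -> R) (ed : nat -> nat)
  (y s : nat -> nat -> R).
Hypothesis sched : schedule K M time ed y s.
Notation V := 'rV[R]_3.
Implicit Types (t tau : R) (xi v : nat -> V) (S : (nat -> V) * (nat -> V)) (k l m : nat).

(** The size of the displacements: small against t^k for every edge k, so that the
    curvature of the walls disappears in the limit. *)
Definition eps t : R := t ^+ K.+1.
(** A state consists of displacements and velocities, both in units of [eps t].
    [arm] is the vector between the centers of the balls of an edge; [clearance]
    is half the excess of its square over 1, in units of the scale of the edge, and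
    [rate] and [curv] are the first two derivatives of that.  The square is used
    instead of the length because it is quadratic in time. *)
Definition rel v k : V := v k - v (par k).
Definition arm t xi k : V := dir t k + eps t *: rel xi k.
Definition clearance t xi k : R := (dot (arm t xi k) (arm t xi k) - 1) / (2 * (eps t * t ^+ k)).
Definition rate t xi v k : R := dot (arm t xi k) (rel v k) / t ^+ k.
Definition curv t v k : R := eps t / t ^+ k * dot (rel v k) (rel v k).
Definition drift tau S x : V := S.1 x + tau *: S.2 x.

(** The smaller root of the quadratic equation for the time of contact, written so
    that it stays meaningful when the leading coefficient tends to 0. *)
Definition flight t S k : R :=
  2 * clearance t S.1 k /
  (Num.sqrt (rate t S.1 S.2 k ^+ 2 - 2 * curv t S.2 k * clearance t S.1 k) - rate t S.1 S.2 k).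

Definition bounce t xi v k x : V :=
  v x + (dot (arm t xi k) (rel v k) * push R k x) *: arm t xi k.

Definition step t k S : (nat -> V) * (nat -> V) :=
  let xi := drift (flight t S k) S in (xi, bounce t xi S.2 k).

(** The collisions are prescribed to be those of the schedule; that no others occur
    is only known later, for small t. *)
Fixpoint sim t m : (nat -> V) * (nat -> V) :=
  if m is m'.+1 then step t (ed m') (sim t m') else
  (place (fun k => (t ^+ k * y 0%N k) *: dir t k), place (fun k => - t ^+ k *: dir t k)).

Lemma arm_drift t tau S k : arm t (drift tau S) k = arm t S.1 k + (tau * eps t) *: rel S.2 k.
Proof.
rewrite /arm -addrA [tau * _]mulrC -scalerA -scalerDr; congr (_ + _ *: _).
by rewrite /rel /drift scalerBr addrACA opprD.
Qed.

Section Exact.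
Variable t : R.
Hypothesis t0 : 0 < t.

Let t_neq0 : t != 0. Proof. by rewrite gt_eqF. Qed.
Let eps_neq0 : eps t != 0. Proof. by rewrite expf_neq0. Qed.

Lemma clearance_drift tau S k : clearance t (drift tau S) k =
  clearance t S.1 k + tau * rate t S.1 S.2 k + tau ^+ 2 / 2 * curv t S.2 k.
Proof.
have tk := expf_neq0 k t_neq0.
rewrite /clearance /rate /curv arm_drift; move: (arm t S.1 k) (rel S.2 k) => a w.
rewrite dotDl !dotDr !dotZl !dotZr (dotC w a).
by field; rewrite tk eps_neq0.
Qed.

Lemma rate_drift tau S k : rate t (drift tau S) S.2 k =
  rate t S.1 S.2 k + tau * curv t S.2 k.
Proof.
have tk := expf_neq0 k t_neq0.
rewrite /rate /curv arm_drift; move: (arm t S.1 k) (rel S.2 k) => a w.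
by rewrite dotDl dotZl; field; rewrite tk.
Qed.

Lemma clearance_flight S k :
  0 <= rate t S.1 S.2 k ^+ 2 - 2 * curv t S.2 k * clearance t S.1 k ->
  0 < Num.sqrt (rate t S.1 S.2 k ^+ 2 - 2 * curv t S.2 k * clearance t S.1 k) - rate t S.1 S.2 k ->
  clearance t (drift (flight t S k) S) k = 0.
Proof.
rewrite clearance_drift /flight; set h := clearance _ _ _; set r := rate _ _ _ _; set A := curv _ _ _.
set q := Num.sqrt _ => D0 qr; have qq : q ^+ 2 = r ^+ 2 - 2 * A * h by rewrite sqr_sqrtr.
have {}qr : q - r != 0 by rewrite gt_eqF.
suff -> : h + 2 * h / (q - r) * r + (2 * h / (q - r)) ^+ 2 / 2 * A =
    h * (q ^+ 2 - (r ^+ 2 - 2 * A * h)) / (q - r) ^+ 2 by rewrite qq subrr mulr0 mul0r.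
by field.
Qed.

Lemma rate_bounce xi v k l : rate t xi (bounce t xi v k) l = rate t xi v l +
  rate t xi v k * ((push R k l - push R k (par l)) *
    (t ^+ k / t ^+ l * dot (arm t xi k) (arm t xi l))).
Proof.
have tk := expf_neq0 k t_neq0; have tl := expf_neq0 l t_neq0.
rewrite /rate; have -> : rel (bounce t xi v k) l = rel v l +
    (dot (arm t xi k) (rel v k) * (push R k l - push R k (par l))) *: arm t xi k.
  rewrite /rel /bounce; move: (push R k l) (push R k (par l)) => p1 p2.
  by rewrite mulrBr scalerBl opprD [LHS]addrACA.
move: (arm t xi l) (arm t xi k) (rel v l) (rel v k) => a b w z.
by rewrite dotDr dotZr (dotC a b); field; rewrite tk tl.
Qed.

End Exact.

Definition convergent (f : R -> nat -> V) : Prop := forall x, exists c, tends (f ^~ x) c.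

Lemma tends_eps : tends eps 0.
Proof. by refine (tends_eq (tendsX K.+1 (@tends_id R)) _); rewrite expr0n. Qed.

Lemma convergent_rel f k : convergent f -> exists c, tends (fun t => rel (f t) k) c.
Proof.
move=> bf; have [a fa] := bf k; have [b fb] := bf (par k).
by exists (a - b); exact: tendsB.
Qed.

Lemma tends_arm f k : convergent f -> tends (fun t => arm t (f t) k) (dir 0 k).
Proof.
move=> /(convergent_rel k)[c fc].
by refine (tends_eq (tendsD (tends_dir R k) (tendsZ tends_eps fc)) _); rewrite scale0r addr0.
Qed.

Lemma tends_eps_div k : (k <= K)%N -> tends (fun t => eps t / t ^+ k) 0.
Proof.
move=> kK; refine (tends_near (f := fun t => t ^+ (K.+1 - k)) _ _) => [t t0|].
  by rewrite /eps -{2}(subnK (leqW kK)) exprD mulfK // expf_neq0 // gt_eqF.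
by refine (tends_eq (tendsX _ (@tends_id R)) _); rewrite expr0n gtn_eqF // subn_gt0 ltnS.
Qed.

Lemma tends_curv f k : (k <= K)%N -> convergent f -> tends (fun t => curv t (f t) k) 0.
Proof.
move=> kK /(convergent_rel k)[c fc].
by refine (tends_eq (tendsM (tends_eps_div kK) (tends_dot fc fc)) _); rewrite mul0r.
Qed.

(** The perturbation of the directions is of order [eps t] and thus negligible
    even after division by the scale of the slower edge. *)
Lemma tends_response f k l : (0 < k)%N -> (0 < l <= K)%N -> convergent f ->
  tends (fun t => (push R k l - push R k (par l)) *
    (t ^+ k / t ^+ l * dot (arm t (f t) k) (arm t (f t) l))) (response R k l).
Proof.
move=> k0 /andP[l0 lK] bf; have [a fa] := convergent_rel k bf; have [b fb] := convergent_rel l bf.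
have tk := tendsX k (@tends_id R).
have small : tends (fun t => (push R k l - push R k (par l)) * (t ^+ k *
    (eps t / t ^+ l * (dot (dir t k) (rel (f t) l) + dot (rel (f t) k) (dir t l)
      + eps t * dot (rel (f t) k) (rel (f t) l))))) 0.
  refine (tends_eq (tendsM (tends_cst _) (tendsM tk (tendsM (tends_eps_div lK)
    (tendsD (tendsD (tends_dot (tends_dir R k) fb) (tends_dot fa (tends_dir R l)))
      (tendsM tends_eps (tends_dot fa fb)))))) _).
  by rewrite mul0r !mulr0.
have main := tendsD (tends_coupling R k0 l0) small.
refine (tends_eq (tends_near _ main) _); last by rewrite addr0.
move=> t t0; rewrite /arm.
move: (rel (f t) k) (rel (f t) l) (dir t k) (dir t l) (push R k l - _) => w z d e c.
by rewrite dotDl !dotDr !dotZl !dotZr; field; rewrite expf_neq0 // gt_eqF.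
Qed.

(** Clearances and rates are treated separately because they are divided by a
    power of t, so that their limits do not follow from those of the displacements
    and velocities. *)
Definition stage m (f : R -> (nat -> V) * (nat -> V)) : Prop :=
  [/\ convergent (fun t => (f t).1), convergent (fun t => (f t).2) &
    forall k, (0 < k <= K)%N -> tends (fun t => clearance t (f t).1 k) (y m k) /\
      tends (fun t => rate t (f t).1 (f t).2 k) (s m k)].

Lemma stage_start : stage 0 (sim ^~ 0%N).
Proof.
have tk k := tendsX k (@tends_id R).
split=> [x|x|k kK] /=.
- eexists; apply: tends_place => k; apply: tendsZ; last exact: tends_dir.
  exact: tendsM (tk k) (tends_cst _).
- eexists; apply: tends_place => k; apply: tendsZ; last exact: tends_dir.
  exact: tendsN (tk k).
have k0 : (0 < k)%N by case/andP: kK.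
have [s0 _] := sched_start sched kK; rewrite s0.
have armE t : arm t (sim t 0).1 k = (1 + eps t * (t ^+ k * y 0%N k)) *: dir t k.
  by rewrite /arm /rel /= place_par // scalerDl scale1r scalerA.
have relE t : rel (sim t 0).2 k = - t ^+ k *: dir t k by rewrite /rel /= place_par.
have small : tends (fun t => eps t * (t ^+ k * y 0%N k)) 0.
  refine (tends_eq (tendsM tends_eps (tendsM (tk k) (tends_cst (y 0%N k)))) _).
  by rewrite mul0r.
split.
  refine (tends_near (f := fun t => y 0%N k + eps t * (t ^+ k * y 0%N k) * (y 0%N k / 2)) _ _).
    move=> t t0; rewrite /clearance armE dotZl dotZr dot_dir //.
    by field; rewrite /eps !expf_neq0 // gt_eqF.
  by refine (tends_eq (tendsD (tends_cst _) (tendsM small (tends_cst _))) _); rewrite mul0r addr0.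
refine (tends_near (f := fun t => - (1 + eps t * (t ^+ k * y 0%N k))) _ _).
  move=> t t0; rewrite /rate armE relE dotZl dotZr dot_dir //.
  by field; rewrite expf_neq0 // gt_eqF.
by refine (tends_eq (tendsN (tendsD (tends_cst _) small)) _); rewrite addr0.
Qed.

(** One flight and one collision: clearances and rates follow the schedule during
    the flight since [curv] tends to 0, and at the collision by [tends_response]. *)
Section Step.
Variable m : nat.
Hypotheses (mM : (m < M)%N) (stm : stage m (sim ^~ m)).

Let kappa := ed m.
Let kappaK : (0 < kappa <= K)%N := sched_edge sched mM.

Lemma tends_discr : tends (fun t => rate t (sim t m).1 (sim t m).2 kappa ^+ 2 -
   2 * curv t (sim t m).2 kappa * clearance t (sim t m).1 kappa) 1.
Proof.
have [_ bv H] := stm; have [hy hr] := H _ kappaK.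
have [_ sk] := sched_hit sched mM.
have hc := tends_curv (proj2 (andP kappaK)) bv.
refine (tends_eq (tendsB (tendsX 2 hr) (tendsM (tendsM (@tends_cst R R 2) hc) hy)) _).
by rewrite sk mulr0 mul0r subr0 sqrrN expr1n.
Qed.

Lemma tends_speed_sum : tends (fun t =>
   Num.sqrt (rate t (sim t m).1 (sim t m).2 kappa ^+ 2 -
   2 * curv t (sim t m).2 kappa * clearance t (sim t m).1 kappa)
   - rate t (sim t m).1 (sim t m).2 kappa) 2.
Proof.
have [_ _ H] := stm; have [_ hr] := H _ kappaK; have [_ sk] := sched_hit sched mM.
refine (tends_eq (tendsB (tends_sqrt tends_discr) hr) _).
by rewrite sk sqrtr1 opprK.
Qed.

Lemma tends_flight : tends (fun t => flight t (sim t m) kappa) (time m.+1 - time m).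
Proof.
have [_ _ H] := stm; have [hy _] := H _ kappaK; have [y0 sk] := sched_hit sched mM.
have two : (2 : R) != 0 by [].
refine (tends_eq (tendsM (tendsM (@tends_cst R R 2) hy) (tendsV two tends_speed_sum)) _).
have := sched_flight sched mM kappaK; rewrite -/kappa y0 sk => E.
have -> : y m kappa = time m.+1 - time m by move: E; lra.
by field.
Qed.

Let after t := drift (flight t (sim t m) kappa) (sim t m).

Lemma convergent_after : convergent after.
Proof.
have [bx bv _] := stm; move=> x; have [a xa] := bx x; have [b vb] := bv x.
by eexists; exact: tendsD xa (tendsZ tends_flight vb).
Qed.

Lemma tends_clearance_after k : (0 < k <= K)%N -> tends (fun t => clearance t (after t) k) (y m.+1 k).
Proof.
move=> kK; have [_ bv H] := stm; have [hy hr] := H _ kK.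
have hc := tends_curv (proj2 (andP kK)) bv; have tf := tends_flight.
have E := tendsD (tendsD hy (tendsM tf hr))
  (tendsM (tendsM (tendsX 2 tf) (@tends_cst R R 2^-1)) hc).
refine (tends_eq (tends_near _ E) _) => [t t0|]; first by rewrite clearance_drift.
by rewrite (sched_flight sched mM kK) mulr0 addr0.
Qed.

Lemma tends_rate_after k : (0 < k <= K)%N ->
  tends (fun t => rate t (after t) (sim t m).2 k) (s m k).
Proof.
move=> kK; have [_ bv H] := stm; have [hy hr] := H _ kK.
have hc := tends_curv (proj2 (andP kK)) bv; have tf := tends_flight.
refine (tends_eq (tends_near _ (tendsD hr (tendsM tf hc))) _) => [t t0|].
  by rewrite rate_drift.
by rewrite mulr0 addr0.
Qed.

Lemma stage_step : stage m.+1 (sim ^~ m.+1).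
Proof.
have [_ bv _] := stm; have ba := convergent_after.
split=> [||k kK]; first exact: ba.
- move=> x; have [b vb] := bv x; have [c rc] := convergent_rel kappa bv.
  have ta := tends_arm kappa ba.
  by eexists; exact: tendsD vb (tendsZ (tendsM (tends_dot ta rc) (tends_cst (push R kappa x))) ta).
split; first exact: tends_clearance_after.
refine (tends_eq (tends_near _ (tendsD (tends_rate_after kK)
  (tendsM (tends_rate_after kappaK) (tends_response (proj1 (andP kappaK)) kK ba)))) _).
  by move=> t t0; rewrite rate_bounce.
by rewrite (sched_kick sched mM kK) mulrC.
Qed.

End Step.

Lemma stage_sim m : (m <= M)%N -> stage m (sim ^~ m).
Proof.
elim: m => [|m IH] mM; first exact: stage_start.
by apply: stage_step => //; apply: IH; exact: ltnW.
Qed.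

(** * Small parameters realise the schedule *)

Lemma near_all n (P : nat -> R -> Prop) :
  (forall k, (k < n)%N -> \forall t \near 0^'+, P k t) ->
  \forall t \near 0^'+, forall k, (k < n)%N -> P k t.
Proof.
elim: n => [|n IH] H; first by near=> t => k.
have H1 := IH (fun k kn => H k (leqW kn)); have H2 := H n (ltnSn n).
near=> t => k; rewrite ltnS leq_eqVlt => /orP[/eqP ->|]; first by near: t.
by move: k; near: t.
Unshelve. all: by end_near. Qed.

(** After the last collision the balls are followed for one more unit of time. *)
Definition duration t m : R := if (m < M)%N then flight t (sim t m) (ed m) else 1.

Lemma curv_ge0 t v k : 0 < t -> 0 <= curv t v k.
Proof. by move=> t0; rewrite mulr_ge0 ?dot_ge0 // divr_ge0 ?exprn_ge0 // ltW. Qed.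

Lemma near_hit m : (m < M)%N -> \forall t \near 0^'+,
  [/\ 0 < flight t (sim t m) (ed m), clearance t (sim t m.+1).1 (ed m) = 0 &
      rate t (sim t m.+1).1 (sim t m).2 (ed m) < 0].
Proof.
move=> mM; have st := stage_sim (ltnW mM); have eK := sched_edge sched mM.
have H1 : \forall t \near 0^'+, 0 < flight t (sim t m) (ed m).
  by apply: tends_gt (tends_flight mM st) _; rewrite subr_gt0 (sched_time sched).
have H2 := tends_gt (tends_discr mM st) ltr01.
have H3 := tends_gt (tends_speed_sum mM st) (ltr0Sn R 1).
have H4 := tends_lt (tends_rate_after mM st eK) (_ : _ < 0).
have sk := (sched_hit sched mM).2.
near=> t; have t0 : 0 < t by near: t; exact: nbhs_right_gt.
split; first by near: t.
  by apply: clearance_flight => //; [apply: ltW; near: t | near: t].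
by near: t; apply: H4; rewrite sk ltrN10.
Unshelve. all: by end_near. Qed.

Lemma near_miss m k : (m < M)%N -> (0 < k <= K)%N -> k != ed m ->
  \forall t \near 0^'+, 0 < clearance t (sim t m.+1).1 k.
Proof.
move=> mM kK ke; have st := stage_sim (ltnW mM).
exact: tends_gt (tends_clearance_after mM st kK) (sched_miss sched mM kK ke).
Qed.

Lemma near_clearance_ge0 m k : (m <= M)%N -> (0 < k <= K)%N ->
  \forall t \near 0^'+, 0 <= clearance t (sim t m).1 k.
Proof.
case: m => [|m] mM kK.
  have [_ _ /(_ k kK)[hy _]] := stage_sim mM; have [_ y0] := sched_start sched kK.
  by apply: filterS (tends_gt hy y0) => t /ltW.
case: (eqVneq k (ed m)) => [->|ke]; last first.
  by apply: filterS (near_miss mM kK ke) => t /ltW.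
by apply: filterS (near_hit mM) => t [_ -> _].
Qed.

(** The clearance is a convex function of time, so its sign inside a flight is not
    decided by its values at the ends.  If the limiting slope is 1, it increases
    from a nonnegative value; if the slope is -1, it is compared with its
    nonnegative value at the next collision, backwards in time. *)
Lemma near_apart m k : (m <= M)%N -> (0 < k <= K)%N ->
  \forall t \near 0^'+, forall tau, 0 < tau < duration t m -> 0 < clearance t (drift tau (sim t m)) k.
Proof.
move=> mM kK; have [_ _ /(_ k kK)[hy hr]] := stage_sim mM.
have h0 := near_clearance_ge0 mM kK.
have [s1|s1] := sched_slope sched mM kK; rewrite s1 in hr.
  have r0 := tends_gt hr ltr01.
  near=> t => tau /andP[tau0 _].
  have t0 : 0 < t by near: t; exact: nbhs_right_gt.
  have : 0 <= clearance t (sim t m).1 k by near: t.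
  have : 0 < rate t (sim t m).1 (sim t m).2 k by near: t.
  have := curv_ge0 (sim t m).2 k t0; rewrite clearance_drift //.
  move: (clearance _ _ _) (rate _ _ _ _) (curv _ _ _) => h r c c0 rp hp.
  by have := mulr_gt0 tau0 rp; have := mulr_ge0 (sqr_ge0 tau) c0; lra.
have {}mM : (m < M)%N.
  rewrite ltn_neqAle mM andbT; apply/eqP => mE.
  by have := sched_end sched kK; rewrite -mE s1; lra.
have hra := tends_rate_after mM (stage_sim (ltnW mM)) kK; rewrite s1 in hra.
have r0 := tends_lt hra (ltrN10 R).
have h1 := near_clearance_ge0 mM kK.
near=> t => tau; rewrite /duration mM => /andP[tau0 tauf].
have t0 : 0 < t by near: t; exact: nbhs_right_gt.
have : 0 <= clearance t (sim t m.+1).1 k by near: t.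
have : rate t (sim t m.+1).1 (sim t m).2 k < 0 by near: t.
have := curv_ge0 (sim t m).2 k t0.
rewrite [(sim t m.+1).1]/= rate_drift // !clearance_drift //.
move: tauf; move: (clearance _ _ _) (rate _ _ _ _) (curv _ _ _) (flight _ _ _) => h r c f tauf c0 rp hp.
have ft : 0 < f - tau by rewrite subr_gt0.
have a1 : 0 < (f - tau) * - (r + f * c) by rewrite mulr_gt0 // oppr_gt0.
have a2 : 0 <= (f - tau) ^+ 2 * c by rewrite mulr_ge0 // sqr_ge0.
by lra.
Unshelve. all: by end_near. Qed.

Definition center t m tau x : V := base t x + eps t *: drift tau (sim t m) x.

Lemma near_duration m : (m <= M)%N -> exists2 C, 0 < C & \forall t \near 0^'+, duration t m < C.
Proof.
rewrite leq_eqVlt => /orP[/eqP ->|mM].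
  by exists 2 => //; near=> t; rewrite /duration ltnn; lra.
exists (time m.+1 - time m + 1); first by have := sched_time sched mM; lra.
rewrite /duration mM; apply: tends_lt (tends_flight mM (stage_sim (ltnW mM))) _; lra.
Unshelve. all: by end_near. Qed.

(** The balls x and z do not touch in the limiting configuration and are displaced
    by an amount that tends to 0, as the duration stays bounded. *)
Lemma near_far m x z : (m <= M)%N -> (x < z)%N -> x <> par z ->
  \forall t \near 0^'+, forall tau, 0 <= tau <= duration t m ->
    1 < dot (center t m tau x - center t m tau z) (center t m tau x - center t m tau z).
Proof.
move=> mM xz xp; have [bx bv _] := stage_sim mM; have [C C0 durC] := near_duration mM.
pose d0 t := base t x - base t z + eps t *: ((sim t m).1 x - (sim t m).1 z).
pose w t := (sim t m).2 x - (sim t m).2 z.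
have [a xa] := bx x; have [b zb] := bx z; have [c vc] := bv x; have [e ve] := bv z.
have bt u : tends (fun t : R => base t u) (base 0 u) by apply: tends_place => k; exact: tends_dir.
have td : tends d0 (base 0 x - base 0 z).
  refine (tends_eq (tendsD (tendsB (bt x) (bt z)) (tendsZ tends_eps (tendsB xa zb))) _).
  by rewrite scale0r addr0.
have n1 := tends_gt (tends_dot td td) (_ : 11 / 8 < _).
have tw : tends (fun t => eps t * dot (d0 t) (w t) * C) 0.
  refine (tends_eq (tendsM (tendsM tends_eps (tends_dot td (tendsB vc ve))) (tends_cst C)) _).
  by rewrite !mul0r.
have n2 := tends_gt tw (_ : - (1 / 8) < 0).
near=> t => tau /andP[tau0 taud].
have : duration t m < C by near: t.
have : 11 / 8 < dot (d0 t) (d0 t).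
  by near: t; apply: n1; have := base_far R xz xp; lra.
have : - (1 / 8) < eps t * dot (d0 t) (w t) * C by near: t; apply: n2; lra.
have -> : center t m tau x - center t m tau z = d0 t + (tau * eps t) *: w t.
  rewrite /center /drift /d0 /w [tau * _]mulrC -scalerA.
  by apply/rowP => i; rewrite !mxE; ring.
move: (d0 t) (w t) => d u; rewrite dotDl !dotDr !dotZl !dotZr (dotC u d).
have := dot_ge0 u; move: (dot u u) (dot d u) (dot d d) => ww dw dd ww0 n2' n1' dC.
have : 0 <= (tau * eps t) * ((tau * eps t) * ww) by rewrite mulrA -expr2 mulr_ge0 // sqr_ge0.
have tC : tau <= C by apply: le_trans taud (ltW dC).
(* the square norm of d + (tau eps) u is at least 11/8 - 2/8 *)
have : - (1 / 8) < tau * (eps t * dw).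
  have [p|p] := leP 0 (eps t * dw); first by have := mulr_ge0 tau0 p; lra.
  have : C * (eps t * dw) <= tau * (eps t * dw) by rewrite ler_wnM2r // ltW.
  by move: n2'; lra.
by lra.
Unshelve. all: by end_near. Qed.

Lemma exists_good : exists t, [/\ 0 < t,
  forall m, (m < M)%N -> [/\ 0 < flight t (sim t m) (ed m), clearance t (sim t m.+1).1 (ed m) = 0 &
      rate t (sim t m.+1).1 (sim t m).2 (ed m) < 0],
  forall m, (m < M)%N -> forall k, (0 < k <= K)%N -> k != ed m -> 0 < clearance t (sim t m.+1).1 k,
  forall m, (m <= M)%N -> forall k, (0 < k <= K)%N ->
    forall tau, 0 < tau < duration t m -> 0 < clearance t (drift tau (sim t m)) k &
  forall m, (m <= M)%N -> forall x z, (x < z <= K)%N -> x <> par z ->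
    forall tau, 0 <= tau <= duration t m ->
    1 < dot (center t m tau x - center t m tau z) (center t m tau x - center t m tau z)].
Proof.
have imp (A : Prop) (P : R -> Prop) : (A -> \forall t \near 0^'+, P t) ->
    \forall t \near 0^'+, A -> P t.
  by move=> H; have [/H|nA] := pselect A; [apply: filterS | near=> t => /nA].
have H1 := near_all near_hit.
have H2 : \forall t \near 0^'+, forall m, (m < M)%N -> forall k, (k < K.+1)%N ->
    (0 < k)%N /\ k != ed m -> 0 < clearance t (sim t m.+1).1 k.
  apply: near_all => m mM; apply: near_all => k kK; apply: imp => -[k0 ke].
  by apply: near_miss => //; rewrite k0.
have H3 : \forall t \near 0^'+, forall m, (m < M.+1)%N -> forall k, (k < K.+1)%N ->
    (0 < k)%N -> forall tau, 0 < tau < duration t m -> 0 < clearance t (drift tau (sim t m)) k.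
  apply: near_all => m mM; apply: near_all => k kK; apply: imp => k0.
  by apply: near_apart => //; rewrite k0.
have H4 : \forall t \near 0^'+, forall m, (m < M.+1)%N -> forall z, (z < K.+1)%N ->
    forall x, (x < z)%N -> x <> par z -> forall tau, 0 <= tau <= duration t m ->
    1 < dot (center t m tau x - center t m tau z) (center t m tau x - center t m tau z).
  apply: near_all => m mM; apply: near_all => z zK; apply: near_all => x xz.
  by apply: imp => xp; exact: near_far.
near ((0 : R)^'+) => t; exists t.
have t0 : 0 < t by near: t; exact: nbhs_right_gt.
have h2 : forall m, (m < M)%N -> forall k, (k < K.+1)%N ->
    (0 < k)%N /\ k != ed m -> 0 < clearance t (sim t m.+1).1 k by near: t.
have h3 : forall m, (m < M.+1)%N -> forall k, (k < K.+1)%N -> (0 < k)%N ->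
    forall tau, 0 < tau < duration t m -> 0 < clearance t (drift tau (sim t m)) k by near: t.
have h4 : forall m, (m < M.+1)%N -> forall z, (z < K.+1)%N ->
    forall x, (x < z)%N -> x <> par z -> forall tau, 0 <= tau <= duration t m ->
    1 < dot (center t m tau x - center t m tau z) (center t m tau x - center t m tau z) by near: t.
split=> //.
- by near: t.
- by move=> m mM k /andP[k0 kK] ke; apply: h2.
- by move=> m mM k /andP[k0 kK]; apply: h3.
- by move=> m mM x z /andP[xz zK]; apply: h4.
Unshelve. all: by end_near. Qed.

Lemma clearance_eq0 t xi k : 0 < t -> clearance t xi k = 0 -> dot (arm t xi k) (arm t xi k) = 1.
Proof.
move=> t0 /eqP; rewrite mulf_eq0 invr_eq0 !mulf_eq0 !expf_eq0 (gt_eqF t0) !andbF !orbF.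
by rewrite subr_eq0 pnatr_eq0 orbF => /eqP.
Qed.

Lemma clearance_gt0 t xi k : 0 < t -> (0 < clearance t xi k) = (1 < dot (arm t xi k) (arm t xi k)).
Proof. by move=> t0; rewrite pmulr_lgt0 ?subr_gt0 // invr_gt0 !mulr_gt0 // exprn_gt0. Qed.

Lemma arm_center t m tau k : (0 < k)%N ->
  arm t (drift tau (sim t m)) k = center t m tau k - center t m tau (par k).
Proof. by move=> k0; rewrite /arm /center opprD addrACA /base place_par // -scalerBr. Qed.

Definition centers t m tau : 'M[R]_(K.+1, 3) := \matrix_(i < K.+1) center t m tau i.
Definition velocities t m : 'M[R]_(K.+1, 3) := \matrix_(i < K.+1) (eps t *: (sim t m).2 i).
Definition clock t m : R := \sum_(i < m) duration t i.

Lemma centers_drift t m tau : centers t m tau = centers t m 0 + tau *: velocities t m.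
Proof.
apply/row_matrixP => i; rewrite linearD linearZ /= !rowK /center /drift scale0r addr0.
by rewrite scalerDr addrA !scalerA [tau * _]mulrC.
Qed.

Lemma centers_succ t m : (m < M)%N -> centers t m.+1 0 = centers t m (duration t m).
Proof.
move=> mM; apply/row_matrixP => i; rewrite !rowK /center /duration mM.
by rewrite {1}/drift scale0r addr0.
Qed.

Lemma sqdist_centers t m tau (i j : 'I_K.+1) : sqdist i j (centers t m tau) =
  dot (center t m tau i - center t m tau j) (center t m tau i - center t m tau j).
Proof. by rewrite /sqdist !rowK. Qed.

Lemma sqdist_arm t m tau (i j : 'I_K.+1) : (i < j)%N -> i = par j :> nat ->
  sqdist i j (centers t m tau) =
  dot (arm t (drift tau (sim t m)) j) (arm t (drift tau (sim t m)) j).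
Proof.
move=> ij iE; rewrite sqdist_centers arm_center; last exact: leq_ltn_trans ij.
by rewrite iE -opprB dotNl dotNr opprK.
Qed.

Lemma schedule_MaxCol : (M%:R%:E <= MaxCol R K.+1 3)%E.
Proof.
have [t [t0 hit miss apart far]] := exists_good.
have eps0 : 0 < eps t by apply: exprn_gt0.
have edK m : (m < M)%N -> (0 < ed m < K.+1)%N by move=> mM; exact: (sched_edge sched mM).
have edE m : (m < M)%N -> (inord (ed m) : 'I_K.+1) = ed m :> nat.
  by move=> mM; rewrite inordK //; case/andP: (edK m mM).
have parE m : (m < M)%N -> (inord (par (ed m)) : 'I_K.+1) = par (ed m) :> nat.
  move=> mM; rewrite inordK //; have /andP[e0 eK] := edK m mM.
  exact: ltn_trans (par_lt e0) eK.
have d0 m : (m <= M)%N -> 0 < duration t m.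
  by rewrite /duration; case: ifP => // mM _; case: (hit m mM).
have neq m : (m < M)%N -> (inord (par (ed m)) : 'I_K.+1) != inord (ed m).
  move=> mM; rewrite -val_eqE /= parE // edE //; have /andP[e0 _] := edK m mM.
  by rewrite ltn_eqF // par_lt.
have armE m : (m < M)%N -> row (inord (par (ed m))) (centers t m.+1 0) -
    row (inord (ed m)) (centers t m.+1 0) = - arm t (sim t m.+1).1 (ed m).
  move=> mM; have /andP[e0 _] := edK m mM.
  have -> : arm t (sim t m.+1).1 (ed m) = arm t (drift 0 (sim t m.+1)) (ed m).
    by rewrite arm_drift mul0r scale0r addr0.
  by rewrite arm_center // !rowK parE // edE // opprB.
have velE m : (m < M)%N -> row (inord (par (ed m))) (velocities t m) -
    row (inord (ed m)) (velocities t m) = - (eps t *: rel (sim t m).2 (ed m)).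
  by move=> mM; rewrite !rowK parE // edE // -scalerBr -scalerN opprB.
apply: (@billiard_MaxCol R K.+1 3 M (clock t) (fun m => centers t m 0) (velocities t)
  (fun m => inord (par (ed m))) (fun m => inord (ed m))).
have clockS m : clock t m.+1 - clock t m = duration t m.
  by rewrite /clock big_ord_recr addrAC subrr add0r.
split.
- by move=> m mM; rewrite -subr_gt0 clockS d0.
- by move=> m mM; rewrite clockS centers_succ // centers_drift.
- by move=> m mM; rewrite parE // edE // par_lt //; case/andP: (edK m mM).
- move=> m mM; have [_ h0 _] := hit m mM.
  by rewrite /sqdist armE // dotNl dotNr opprK clearance_eq0.
- move=> m mM; apply/row_matrixP => x.
  rewrite row_bounce ?neq // armE // velE // !rowK dotNl dotNr opprK dotZl.
  rewrite [sim t m.+1]/= /bounce -/(sim t m.+1).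
  set a := arm _ _ _; rewrite scalerN opprK scalerDr scalerA; congr (_ + _ *: _).
  rewrite /push -!val_eqE /= parE // edE // (dotC a); ring.
- move=> m mM; have [_ _ r0] := hit m mM.
  rewrite dot_wall_normal ?neq // armE // velE // dotNl dotNr opprK dotZl.
  rewrite mulf_neq0 ?invr_eq0 ?sqrtr_eq0 -?ltNge // mulf_neq0 ?(gt_eqF eps0) //.
  by apply/eqP => E; move: r0; rewrite /rate dotC E mul0r ltxx.
- move=> m k l mM kl kl_ed.
  have lK : (0 < l <= K)%N by rewrite (leq_ltn_trans _ kl) // -ltnS ltn_ord.
  case: (eqVneq (k : nat) (par l)) => [kE|/eqP kE]; last first.
    rewrite sqdist_centers; apply: (far m.+1) => //; first by rewrite kl; case/andP: lK.
    by rewrite lexx ltW // d0.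
  rewrite sqdist_arm // -clearance_gt0 //.
  have -> : clearance t (drift 0 (sim t m.+1)) l = clearance t (sim t m.+1).1 l.
    by rewrite /clearance arm_drift mul0r scale0r addr0.
  apply: miss => //; apply/eqP => lE; apply: kl_ed; split; apply: val_inj => /=.
    by rewrite parE // -lE.
  by rewrite edE.
- move=> m t' k l mM tt kl; rewrite -centers_drift.
  have tau : 0 < t' - clock t m < duration t m.
    by move: tt; rewrite -clockS => /andP[? ?]; apply/andP; split; lra.
  have lK : (0 < l <= K)%N by rewrite (leq_ltn_trans _ kl) // -ltnS ltn_ord.
  case: (eqVneq (k : nat) (par l)) => [kE|/eqP kE]; last first.
    rewrite sqdist_centers; apply: (far m) => //; first by rewrite kl; case/andP: lK.
    by case/andP: tau => /ltW -> /ltW ->.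
  by rewrite sqdist_arm // -clearance_gt0 //; apply: apart.
Qed.

End Simulation.

(** * Exponentially many collisions *)

Theorem theorem1p1 (R : realType) (n : nat) (hn : (3 <= n)%N) :
  (((2 ^ n./2)%:R : R)%:E <= MaxCol R n 3)%E.
Proof.
case: n hn => // K; rewrite ltnS => K2.
have [M [t [ed [y [s [sched MK]]]]]] := schedule_exists R K2.
by apply: le_trans (schedule_MaxCol sched); rewrite lee_fin ler_nat.
Qed.
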